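(* Let $p=3$, let $\mathcal{N}$ be the Nottingham group over $\mathbb{F}_3$, and let $k\ge 1$. Then the quotient $\mathcal{N}/\mathcal{N}_k$ is a Beauville group if and only if $k\ge 6$ and $k\ne z_m$ for all $m\ge 1$.
   Context: The Nottingham group $\mathcal{N}$ over $\mathbb{F}_p$ (here $p=3$) is the group, under composition, of normalised automorphisms of the ring $\mathbb{F}_p[[t]]$; each $f\in\mathcal{N}$ is completely determined by $f(t)=t+\sum_{i\ge 2}a_it^i$, with $a_i\in\mathbb{F}_p$ (all such series occur). For $k\ge 1$, $\mathcal{N}_k$ is the normal subgroup of all $f\in\mathcal{N}$ with $f(t)=t+\sum_{i\ge k+1}a_it^i$. For $m\ge 1$, $z_m=p^m+p^{m-1}+\cdots+p+2$ (with $p=3$). For elements $x,y$ of a finite group $G$ let $\Sigma(x,y)=\bigcup_{g\in G}\big(\langle x\rangle^g\cup\langle y\rangle^g\cup\langle xy\rangle^g\big)$. A Beauville structure for $G$ is a pair of generating sets $\{x_1,y_1\}$, $\{x_2,y_2\}$ of $G$ such that $\Sigma(x_1,y_1)\cap\Sigma(x_2,y_2)=1$. $G$ is a Beauville group if it has a Beauville structure. By convention the groups considered are non-trivial (the trivial quotient $\mathcal{N}/\mathcal{N}_1$ is not regarded as a Beauville group). *)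

(* Defs.v *)
From HB Require Import structures.
From mathcomp Require Import all_boot all_order all_algebra all_fingroup.
From mathcomp Require Import boolp.

Set Implicit Arguments.
Unset Strict Implicit.
Unset Printing Implicit Defensive.

Import GRing.Theory.
Local Open Scope ring_scope.
Local Open Scope quotient_scope.

Section Substitution.
Variable F : fieldType.
Implicit Types (P Q : {poly F}) (f g h : nat -> F).

Lemma dvdXnP n P : reflect (forall i, (i < n)%N -> P`_i = 0) ('X^n %| P).
Proof.
apply: (iffP idP) => [/dvdpP[q ->] i lt_in|P0]; first by rewrite coefMXn lt_in.
rewrite -(poly_take_drop n P) (_ : take_poly n P = 0) ?add0r ?dvdp_mull //.
by apply/polyP=> i; rewrite coef_take_poly coef0; case: ifP => // /P0.
Qed.

Lemma dvdXn_subP n P Q :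
  (forall i, (i < n)%N -> P`_i = Q`_i) <-> 'X^n %| P - Q.
Proof.
split=> [PQ|/dvdXnP PQ i /PQ].
  by apply/dvdXnP=> j /PQ; rewrite coefB => ->; rewrite subrr.
by rewrite coefB => /subr0_eq.
Qed.

Lemma comp_poly_congr n P P' Q Q' : Q`_0 = 0 ->
    (forall i, (i < n)%N -> P`_i = P'`_i) ->
    (forall i, (i < n)%N -> Q`_i = Q'`_i) ->
  forall i, (i < n)%N -> (P \Po Q)`_i = (P' \Po Q')`_i.
Proof.
move=> Q0 /dvdXn_subP dP /dvdXn_subP dQ; apply/dvdXn_subP.
rewrite -(subrKA (P' \Po Q)) dvdp_add //.
  have /dvdpP[q Eq] := dP.
  rewrite -rmorphB /= Eq rmorphM /= comp_Xn_poly dvdp_mull // dvdp_exp2r //.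
  by rewrite -(expr1 'X); apply/dvdXnP=> -[|//] _.
rewrite !comp_polyE -sumrB; elim/big_ind: _ => [|A B|j _].
- exact: dvdp0.
- exact: dvdp_add.
by rewrite -scalerBr -mul_polyC subrXX dvdp_mull // dvdp_mulr.
Qed.

Definition series_trunc n f : {poly F} := \poly_(i < n) f i.

(* f(g(t)) for power series given by their coefficients, with g 0 = 0: the
   terms of degree > n of f and g do not contribute to the coefficient of t^n. *)
Definition series_comp f g : nat -> F :=
  fun n => (series_trunc n.+1 f \Po series_trunc n.+1 g)`_n.

Definition series_id : nat -> F := fun n => (n == 1)%:R.

Lemma coef_trunc n f i : (series_trunc n f)`_i = if (i < n)%N then f i else 0.
Proof. exact: coef_poly. Qed.

Lemma series_compE m f g : g 0 = 0 -> forall n, (n < m)%N ->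
  series_comp f g n = (series_trunc m f \Po series_trunc m g)`_n.
Proof.
move=> g0 n lt_nm; apply: (@comp_poly_congr n.+1) => //= [|i|i];
by rewrite !coef_trunc ?g0 // => lt_in; rewrite lt_in (leq_trans lt_in lt_nm).
Qed.

Lemma series_comp_congr n f f' g g' : g 0 = 0 ->
    (forall i, (i < n)%N -> f i = f' i) ->
    (forall i, (i < n)%N -> g i = g' i) ->
  forall i, (i < n)%N -> series_comp f g i = series_comp f' g' i.
Proof.
move=> g0 eqf eqg i lt_in; apply: (@comp_poly_congr i.+1) => //= [|j|j].
- by rewrite coef_trunc g0.
- by rewrite !coef_trunc => lt_ji; rewrite lt_ji eqf // (leq_trans lt_ji).
by rewrite !coef_trunc => lt_ji; rewrite lt_ji eqg // (leq_trans lt_ji).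
Qed.

Lemma series_comp_low f g : f 0 = 0 -> g 0 = 0 ->
  series_comp f g 0 = 0 /\ series_comp f g 1 = f 1 * g 1.
Proof.
move=> f0 g0; rewrite !(@series_compE 2) // comp_polyE.
have sz : (size (series_trunc 2 f) <= 2)%N by apply: size_poly.
rewrite -(big_mkord predT (fun i => (series_trunc 2 f)`_i *: series_trunc 2 g ^+ i)).
have -> : \sum_(0 <= i < size (series_trunc 2 f))
    (series_trunc 2 f)`_i *: series_trunc 2 g ^+ i = f 1 *: series_trunc 2 g.
  rewrite (big_nat_widen _ _ 2) //= big_mkcond /= !big_nat_recl // big_geq //.
  rewrite !coef_trunc /= f0 !scale0r if_same add0r addr0 expr1.
  case: ltnP => // /(nth_default 0); rewrite coef_trunc /= => ->.
  by rewrite scale0r.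
by rewrite !coefZ !coef_trunc /= g0 mulr0.
Qed.

Lemma series_trunc_comp n f g i : g 0 = 0 -> (i < n)%N ->
  (series_trunc n (series_comp f g))`_i
    = (series_trunc n f \Po series_trunc n g)`_i.
Proof. by move=> g0 lt_in; rewrite coef_trunc lt_in (@series_compE n). Qed.

Lemma series_compA f g h : f 0 = 0 -> g 0 = 0 -> h 0 = 0 ->
  series_comp f (series_comp g h) = series_comp (series_comp f g) h.
Proof.
move=> f0 g0 h0; apply/funext=> n.
have [gh0 _] := series_comp_low g0 h0.
rewrite (series_compE f gh0 (ltnSn n)) (series_compE _ h0 (ltnSn n)).
transitivity ((series_trunc n.+1 f \Po
                 (series_trunc n.+1 g \Po series_trunc n.+1 h))`_n).
  apply: (@comp_poly_congr n.+1) => // [|i lt_in].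
    by rewrite coef_trunc gh0.
  exact: series_trunc_comp.
rewrite comp_polyA; apply: (@comp_poly_congr n.+1) => // [|i lt_in].
  by rewrite coef_trunc h0.
by rewrite series_trunc_comp.
Qed.

Lemma series_comp1f f : f 0 = 0 -> series_comp series_id f = f.
Proof.
move=> f0; apply/funext=> -[|n]; first by rewrite (series_comp_low _ f0).1 ?f0.
rewrite /series_comp (_ : series_trunc n.+2 series_id = 'X).
  by rewrite comp_polyX coef_trunc ltnSn.
apply/polyP=> i; rewrite coef_trunc coefX /series_id.
by case: ltnP => // lt_ni; rewrite gtn_eqF // (leq_trans _ lt_ni).
Qed.

Lemma series_compf1 f : f 0 = 0 -> series_comp f series_id = f.
Proof.
move=> f0; apply/funext=> -[|n]; first by rewrite (series_comp_low f0 _).1 ?f0.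
rewrite /series_comp (_ : series_trunc n.+2 series_id = 'X).
  by rewrite comp_polyXr coef_trunc ltnSn.
apply/polyP=> i; rewrite coef_trunc coefX /series_id.
by case: ltnP => // lt_ni; rewrite gtn_eqF // (leq_trans _ lt_ni).
Qed.

(* The coefficients of the left inverse g of f, obtained successively from
   (g(f(t)))_n = g_n + \sum_(i < n) g_i (f(t)^i)_n, for f = t + higher terms. *)
Fixpoint series_inv_seq f n : seq F :=
  if n is n'.+1 then
    let s := series_inv_seq f n' in
    rcons s (series_id n' - \sum_(i < n') s`_i * (series_trunc n f ^+ i)`_n')
  else [::].

Definition series_inv f : nat -> F := fun n => (series_inv_seq f n.+1)`_n.

Lemma size_series_inv_seq f n : size (series_inv_seq f n) = n.
Proof. by elim: n => //= n IH; rewrite size_rcons IH. Qed.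

Lemma nth_series_inv_seq f n i : (i < n)%N ->
  (series_inv_seq f n)`_i = series_inv f i.
Proof.
elim: n => // n IH; rewrite ltnS leq_eqVlt => /predU1P[-> //|lt_in].
by rewrite /= nth_rcons size_series_inv_seq lt_in IH.
Qed.

Lemma series_invE f n : series_inv f n =
  series_id n - \sum_(i < n) series_inv f i * (series_trunc n.+1 f ^+ i)`_n.
Proof.
rewrite {1}/series_inv /= nth_rcons size_series_inv_seq ltnn eqxx.
by congr (_ - _); apply: eq_bigr => i _; rewrite nth_series_inv_seq.
Qed.

Lemma series_inv_low f : f 0 = 0 -> f 1 = 1 ->
  series_inv f 0 = 0 /\ series_inv f 1 = 1.
Proof.
move=> f0 f1; have i0 : series_inv f 0 = 0 by rewrite series_invE big_ord0 subr0.
by rewrite (series_invE f 1) big_ord1 i0 mul0r subr0.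
Qed.

Lemma coef_expr_lead n f : f 0 = 0 -> f 1 = 1 ->
  (series_trunc n.+1 f ^+ n)`_n = 1.
Proof.
move=> f0 f1; pose P := series_trunc n.+1 f.
case: n @P => [|n] P; first by rewrite expr0 coef1.
have EP : P = drop_poly 1 P * 'X.
  rewrite -{1}(poly_take_drop 1 P) expr1 (_ : take_poly 1 P = 0) ?add0r //.
  apply/polyP=> -[|i]; rewrite coef_take_poly ?coef0 //=.
  by rewrite coef_trunc f0.
rewrite -/P EP exprMn coefMXn ltnn subnn -horner_coef0 horner_exp horner_coef0.
by rewrite coef_drop_poly coef_trunc add0n f1 expr1n.
Qed.

Lemma series_compVf f : f 0 = 0 -> f 1 = 1 ->
  series_comp (series_inv f) f = series_id.
Proof.
move=> f0 f1; apply/funext=> n; rewrite /series_comp.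
pose g := series_inv f; set P := series_trunc n.+1 f.
have -> : series_trunc n.+1 g \Po P = \sum_(i < n.+1) g i *: P ^+ i.
  rewrite /series_trunc poly_def raddf_sum /=; apply: eq_bigr => i _.
  by rewrite linearZ /= comp_Xn_poly.
rewrite coef_sum big_ord_recr /= coefZ coef_expr_lead // mulr1 /g.
rewrite [X in _ + X]series_invE addrC; under eq_bigr do rewrite coefZ.
by rewrite subrK.
Qed.

End Substitution.

(* The element f of the Nottingham group over F_p is the series
   f(t) = \sum_n f n t^n = t + \sum_(n >= 2) a_n t^n. *)
Record nottingham (p : nat) : Type := Nottingham {
  coefs :> nat -> 'F_p;
  coefs_normalised : (coefs 0%N == 0) && (coefs 1%N == 1)
}.

HB.instance Definition _ p := [isSub for @coefs p].
HB.instance Definition _ p := [Choice of nottingham p by <:].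

Section NottinghamGroup.
Variable p : nat.
Implicit Types f g h : nottingham p.

Lemma coefs0 f : f 0%N = 0. Proof. by case/andP: (coefs_normalised f) => /eqP. Qed.
Lemma coefs1 f : f 1%N = 1. Proof. by case/andP: (coefs_normalised f) => _ /eqP. Qed.

Lemma nottingham_one_subproof :
  (series_id 'F_p 0 == 0) && (series_id 'F_p 1 == 1).
Proof. by rewrite !eqxx. Qed.

Lemma nottingham_mul_subproof f g :
  (series_comp f g 0 == 0) && (series_comp f g 1 == 1).
Proof.
have [-> ->] := series_comp_low (coefs0 f) (coefs0 g).
by rewrite !coefs1 mulr1 !eqxx.
Qed.

Lemma nottingham_inv_subproof f :
  (series_inv f 0 == 0) && (series_inv f 1 == 1).
Proof. by have [-> ->] := series_inv_low (coefs0 f) (coefs1 f); rewrite !eqxx. Qed.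

Definition nottingham_one := Nottingham nottingham_one_subproof.

(* As series, f * g is f(g(t)).  The automorphism f of F_p[[t]] sends h(t) to
   h(f(t)), so as automorphisms f * g is "f, then g", the usual convention of
   the library for products of maps (see perm.v).  The opposite convention
   gives an isomorphic group, through f |-> f^-1. *)
Definition nottingham_mul f g := Nottingham (nottingham_mul_subproof f g).

Definition nottingham_inv f := Nottingham (nottingham_inv_subproof f).

Lemma nottingham_mulA : associative nottingham_mul.
Proof. by move=> f g h; apply/val_inj/series_compA; apply: coefs0. Qed.

Lemma nottingham_mul1g : left_id nottingham_one nottingham_mul.
Proof. by move=> f; apply/val_inj/series_comp1f/coefs0. Qed.

Lemma nottingham_mulg1 : right_id nottingham_one nottingham_mul.
Proof. by move=> f; apply/val_inj/series_compf1/coefs0. Qed.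

Lemma nottingham_mulVg : left_inverse nottingham_one nottingham_inv nottingham_mul.
Proof. by move=> f; apply/val_inj/series_compVf; [apply: coefs0|apply: coefs1]. Qed.

Lemma nottingham_mulgV : right_inverse nottingham_one nottingham_inv nottingham_mul.
Proof.
move=> f; rewrite -[LHS]nottingham_mul1g.
rewrite -[X in nottingham_mul X _](nottingham_mulVg (nottingham_inv f)).
rewrite -nottingham_mulA (nottingham_mulA _ f) nottingham_mulVg nottingham_mul1g.
exact: nottingham_mulVg.
Qed.

HB.instance Definition _ := isGroup.Build (nottingham p) nottingham_mulA
  nottingham_mul1g nottingham_mulg1 nottingham_mulVg nottingham_mulgV.

(* N_k: the coefficients of t^2, ..., t^k vanish. *)
Definition nottingham_sub (k : nat) : {pred nottingham p} :=
  fun f => [forall i : 'I_k.+1, (1 < i)%N ==> (f i == 0)].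

Definition nottingham_eqmod (k : nat) : rel (nottingham p) :=
  fun f g => (f^-1 * g)%g \in nottingham_sub k.

Lemma nottingham_subP k f : reflect
  (forall i, (i < k.+1)%N -> f i = (1%g : nottingham p) i) (f \in nottingham_sub k).
Proof.
apply: (iffP forallP) => [fk i lt_ik|fk i]; last first.
  by apply/implyP => lt1i; rewrite fk //= /series_id gtn_eqF.
have /implyP := fk (Ordinal lt_ik); case: i lt_ik => [|[|i]] lt_ik //= fi.
- by rewrite coefs0.
- by rewrite coefs1.
by rewrite (eqP (fi _)).
Qed.

Lemma nottingham_mul_congr k f f' g g' :
    (forall i, (i < k)%N -> f i = f' i) -> (forall i, (i < k)%N -> g i = g' i) ->
  forall i, (i < k)%N -> (f * g)%g i = (f' * g')%g i.
Proof. by move=> ff' gg'; apply: series_comp_congr => //; apply: coefs0. Qed.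

Lemma nottingham_eqmodP k f g :
  reflect (forall i, (i < k.+1)%N -> f i = g i) (nottingham_eqmod k f g).
Proof.
apply: (iffP (nottingham_subP k _)) => eqfg i lt_ik; last first.
  rewrite -(mulVg f); symmetry; move: i lt_ik.
  by apply: nottingham_mul_congr.
rewrite -[f in LHS]mulg1 -[g](mulVKg f); symmetry; move: i lt_ik.
by apply: nottingham_mul_congr.
Qed.

Lemma nottingham_sub_group_closed k : group_closed (nottingham_sub k).
Proof.
split=> [|f g /nottingham_subP fk /nottingham_subP gk]; first exact/nottingham_subP.
apply/nottingham_subP => i lt_ik; transitivity ((g * g^-1)%g i).
  move: i lt_ik; apply: nottingham_mul_congr => // i lt_ik.
  by rewrite fk ?gk.
by rewrite mulgV.
Qed.

Lemma nottingham_sub_normal k f g :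
  f \in nottingham_sub k -> (f ^ g)%g \in nottingham_sub k.
Proof.
move=> /nottingham_subP fk; apply/nottingham_subP=> i lt_ik.
rewrite -(conj1g g) conjgE [in RHS]conjgE; move: i lt_ik.
by apply: nottingham_mul_congr => //; apply: nottingham_mul_congr.
Qed.

Lemma nottingham_eqmod_refl k : reflexive (nottingham_eqmod k).
Proof. by move=> f; apply/nottingham_eqmodP. Qed.

Lemma nottingham_eqmod_sym k : symmetric (nottingham_eqmod k).
Proof.
by move=> f g; apply/nottingham_eqmodP/nottingham_eqmodP => fg i /fg ->.
Qed.

Lemma nottingham_eqmod_trans k : transitive (nottingham_eqmod k).
Proof.
move=> g f h /nottingham_eqmodP fg /nottingham_eqmodP gh.
by apply/nottingham_eqmodP=> i lt_ik; rewrite fg ?gh.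
Qed.

Canonical nottingham_equiv k := EquivRel (nottingham_eqmod k)
  (@nottingham_eqmod_refl k) (@nottingham_eqmod_sym k) (@nottingham_eqmod_trans k).

Definition nottingham_quotient k := {eq_quot nottingham_equiv k}.

HB.instance Definition _ k := Choice.on (nottingham_quotient k).
HB.instance Definition _ k := EqQuotient.on (nottingham_quotient k).

Section Quotient.
Variable k : nat.
Local Notation Q := (nottingham_quotient k).
Implicit Types a b c : Q.

Lemma nottingham_quotientP f g :
  reflect (\pi_Q f = \pi_Q g) (nottingham_eqmod k f g).
Proof. exact: eqmodP. Qed.

Definition nottingham_quotient_one : Q := \pi_Q 1%g.
Definition nottingham_quotient_mul a b : Q :=
  \pi_Q (generic_quotient.repr a * generic_quotient.repr b)%g.
Definition nottingham_quotient_inv a : Q := \pi_Q (generic_quotient.repr a)^-1%g.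

Lemma nottingham_quotient_piM f g :
  \pi_Q (f * g)%g = nottingham_quotient_mul (\pi_Q f) (\pi_Q g).
Proof.
apply/nottingham_quotientP/nottingham_eqmodP; apply: nottingham_mul_congr.
  by apply/nottingham_eqmodP/nottingham_quotientP; rewrite reprK.
by apply/nottingham_eqmodP/nottingham_quotientP; rewrite reprK.
Qed.

Lemma nottingham_quotient_mulA : associative nottingham_quotient_mul.
Proof.
move=> a b c; rewrite -[a]reprK -[b]reprK -[c]reprK.
set f := generic_quotient.repr a; set g := generic_quotient.repr b.
set h := generic_quotient.repr c.
rewrite -(nottingham_quotient_piM g h) -(nottingham_quotient_piM f g).
rewrite -(nottingham_quotient_piM f (g * h)%g).
by rewrite -(nottingham_quotient_piM (f * g)%g h) mulgA.
Qed.

Lemma nottingham_quotient_mul1g :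
  left_id nottingham_quotient_one nottingham_quotient_mul.
Proof. move=> a; rewrite -[a]reprK; set f := generic_quotient.repr a.
by rewrite -(nottingham_quotient_piM 1%g f) mul1g.
Qed.

Lemma nottingham_quotient_mulVg :
  left_inverse nottingham_quotient_one nottingham_quotient_inv
    nottingham_quotient_mul.
Proof. move=> a; rewrite -[X in nottingham_quotient_mul _ X]reprK.
set f := generic_quotient.repr a.
by rewrite -(nottingham_quotient_piM f^-1%g f) mulVg.
Qed.

Definition nottingham_quotient_code a : {ffun 'I_k.+1 -> 'F_p} := 
  [ffun i : 'I_k.+1 => generic_quotient.repr a i].

Definition nottingham_quotient_decode (v : {ffun 'I_k.+1 -> 'F_p}) : option Q :=
  omap \pi_Q (insub (fun n => if insub n is Some i then v i else (n == 1%N)%:R)).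

Lemma nottingham_quotient_codeK :
  pcancel nottingham_quotient_code nottingham_quotient_decode.
Proof.
move=> a; rewrite /nottingham_quotient_decode; case: insubP => [f _ /= Ef|].
  congr Some; rewrite -[a]reprK; apply/nottingham_quotientP/nottingham_eqmodP.
  by move=> i lt_ik; rewrite Ef insubT ffunE.
case: insubP => [i _ i0|_]; last first.
  by case: insubP => [j _ j1|_]; rewrite ?ffunE ?j1 ?coefs1 !eqxx.
rewrite ffunE i0 coefs0 eqxx.
by case: insubP => [j _ j1|_]; rewrite ?ffunE ?j1 ?coefs1 eqxx.
Qed.

HB.instance Definition _ := PCanIsCountable nottingham_quotient_codeK.
HB.instance Definition _ : isFinite Q := PCanIsFinite nottingham_quotient_codeK.
HB.instance Definition _ := Finite_isGroup.Build Q
  nottingham_quotient_mulA nottingham_quotient_mul1g nottingham_quotient_mulVg.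

Lemma nottingham_piM : {morph \pi_Q : f g / (f * g)%g}.
Proof. exact: nottingham_quotient_piM. Qed.

Lemma nottingham_pi_eq1 f : (\pi_Q f == 1%g) = (f \in nottingham_sub k).
Proof.
apply/eqP/nottingham_subP => [/nottingham_quotientP/nottingham_eqmodP //|fk].
exact/nottingham_quotientP/nottingham_eqmodP.
Qed.

End Quotient.
End NottinghamGroup.

Section Beauville.
Local Open Scope group_scope.
Variables (gT : finGroupType) (G : {group gT}).

Definition beauville_sigma (x y : gT) : {set gT} :=
  \bigcup_(g in G) (<[x]> :^ g :|: <[y]> :^ g :|: <[x * y]> :^ g).

Definition beauville_structure (x1 y1 x2 y2 : gT) : Prop :=
  [/\ <<[set x1; y1]>> = G, <<[set x2; y2]>> = G
    & beauville_sigma x1 y1 :&: beauville_sigma x2 y2 = 1].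

(* The trivial group satisfies the second condition but is excluded. *)
Definition beauville_group : Prop :=
  G :!=: 1 /\ exists x1 y1 x2 y2, beauville_structure x1 y1 x2 y2.

End Beauville.

Definition nottingham_z (p m : nat) : nat := (\sum_(1 <= i < m.+1) p ^ i + 2)%N.

(* Main.v *)
Require Import Defs.
From mathcomp Require Import all_boot all_order all_algebra all_fingroup.
From mathcomp Require Import cyclic ring zify.

Set Implicit Arguments.
Unset Strict Implicit.
Unset Printing Implicit Defensive.

Import GRing.Theory.
Local Open Scope ring_scope.
Local Open Scope quotient_scope.

(** Write [f = t + a t^2 + b t^3 + ...] and [phi f = b - a^2].  The map
    [f |-> (a, phi f)] is a homomorphism of [N] onto [F_3^2] with kernel [N_3].
    For [k >= 3] a generating pair [x, y] of [N/N_k] has independent images, so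
    [x], [y] and [xy] lie in three distinct maximal subgroups out of the four,
    which correspond to the lines of [F_3^2].

    The proof rests on two facts about an element
    [s = t + A t^(n+1) + B t^(n+2) + ...] with [n] congruent to 1 modulo 3.
    - For [n >= 4], if [s] commutes with [f] then [a B = A phi f] ([comm_lead]),
      while the conjugates of [s] have the same [A] and [B] ([conj_lead]).  So a
      power of [f] of such a depth remembers the line of [f], even up to
      conjugation.
    - For [n >= 4], [s^3 = t - A^2 B t^(3n+2) + ...], and for [n = 1] the
      coefficient is [- A^2 (B - A^2)] ([coef_cube_lead]).  This is computed with
      [D = T - 1], where [T] is the substitution of [s] for [t]: in
      characteristic 3, [T^3 - 1 = D^3], and [D (P^3) = (D P)^3] makes cubes
      behave almost like constants.
    Together they show by induction that [f^(3^m)] has depth exactly [z_m - 1]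
    when [a] and [phi f] are both nonzero ([exp3_depth]).

    If [k = z_m], each of two generating pairs provides such an element [f], and
    [f^(3^m)] spans [N_(k-1)/N_k], of order 3: no Beauville structure.  The same
    argument with [m = 0] covers [k = 2].  For [k = 3] or [4], two triples always
    share a line, and elements with the same nonzero image in [F_3^2] are
    conjugate modulo [N_4] ([abel_conj4]).

    If [z_m < k < z_(m+1)] with [m >= 1], let [u] and [v] have order 3 in [N/N_k],
    with images [(0, 1)] and [(1, 0)], and let [u' = t + t^3 + t^5] and
    [v' = t (1 + t)^5], with images [(0, 1)] and [(-1, 0)].  Then [uv] and [u'v']
    have images [(1, 1)] and [(-1, 1)].  The group [<u>] could only meet a
    conjugate of [<u'>], because of the images in [F_3^2], and then [u'] would be
    conjugate to [u], which the coefficient of [t^5] forbids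
    ([ord3_depth2_nonconj]); similarly for [v] and [v'] with the coefficient of
    [t^6] ([ord3_depth1_nonconj]).  Finally every nontrivial subgroup of [<uv>]
    contains [(uv)^(3^m)], of depth [z_m - 1 <= k - 2], and the first fact shows
    that no conjugate of it is a power of [u'], [v'] or [u'v'] ([off_axis_TI]).
    Since [u], [v] and [u'], [v'] generate ([pr_generate]), this is a Beauville
    structure. *)

Local Notation O m P := ('X^m %| P).
Local Notation N := (nottingham 3).
Local Notation "'N_ n" := (nottingham_sub n) (at level 8, n at level 2).
Local Notation tr := (@series_trunc 'F_3).

(** * Divisibility by powers of the variable *)

Section Order.
Variable F : fieldType.
Implicit Types P Q : {poly F}.

Lemma dvdXn_coef m P i : O m P -> (i < m)%N -> P`_i = 0.
Proof. by move/dvdXnP; apply. Qed.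

Lemma dvdXn_le m n P : (m <= n)%N -> O n P -> O m P.
Proof. by move=> le_mn; apply: dvdp_trans; apply: dvdp_exp2l. Qed.

Lemma dvdXnM m n l P Q : (l <= m + n)%N -> O m P -> O n Q -> O l (P * Q).
Proof.
by move=> le_l Pm Qn; apply: dvdXn_le le_l _; rewrite exprD dvdp_mul.
Qed.

Lemma dvdXn_pow m n l P : (l <= m * n)%N -> O m P -> O l (P ^+ n).
Proof. by move=> le_l Pm; apply: dvdXn_le le_l _; rewrite exprM dvdp_exp2r. Qed.

Lemma dvdXn_X m n : (m <= n)%N -> O m ('X^n : {poly F}).
Proof. exact: dvdp_exp2l. Qed.

(** Substituting a series without constant term never lowers the order. *)
Lemma dvdXn_comp m P G : O 1 G -> O m P -> O m (P \Po G).
Proof.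
move=> G1 /dvdpP[Q ->]; rewrite rmorphM /= comp_Xn_poly dvdp_mull //.
by apply: dvdXn_pow G1; rewrite mul1n.
Qed.

(** [comp_diff G] is the operator [D = T - 1] for the substitution [T : P |-> P(G)]. *)
Definition comp_diff (G P : {poly F}) := P \Po G - P.

Section Depth.
Variables (n : nat) (G : {poly F}).
Hypothesis Gn : O n.+1 (G - 'X).

Let G1 : O 1 G.
Proof. by rewrite -(subrK 'X G) dvdp_add // (dvdXn_le _ Gn). Qed.

Lemma comp_diffX : comp_diff G 'X = G - 'X.
Proof. by rewrite /comp_diff comp_polyX. Qed.

Lemma comp_diff_dvd P : O n.+1 (comp_diff G P).
Proof.
apply/dvdXn_subP; rewrite -{2}(comp_polyXr P).
by apply: comp_poly_congr => //; [exact: dvdXn_coef G1 _|apply/dvdXn_subP].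
Qed.

Lemma comp_diff_M P Q :
  comp_diff G (P * Q) = comp_diff G P * (Q \Po G) + P * comp_diff G Q.
Proof. by rewrite /comp_diff rmorphM /=; ring. Qed.

Lemma comp_diff_D P Q : comp_diff G (P + Q) = comp_diff G P + comp_diff G Q.
Proof. by rewrite /comp_diff rmorphD /=; ring. Qed.

Lemma comp_diff_C c P : comp_diff G (c%:P * P) = c%:P * comp_diff G P.
Proof. by rewrite /comp_diff rmorphM /= comp_polyC; ring. Qed.

(** [D] raises orders by the depth [n] of [G]: it does so on powers of [t], and
    [D Q] has order more than [n] for every [Q]. *)
Lemma dvdXn_comp_diff m P : O m P -> O (m + n) (comp_diff G P).
Proof.
move=> /dvdpP[Q ->]; rewrite comp_diff_M dvdp_add //; last first.
  apply: dvdp_mull; rewrite /comp_diff comp_Xn_poly.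
  case/dvdpP: Gn => S ES.
  have -> : G = 'X * (1 + S * 'X^n) by rewrite -(subrK 'X G) ES exprS; ring.
  rewrite exprMn -[X in _ - X]mulr1 -mulrBr exprD dvdp_mul // subrX1.
  by rewrite addrC addKr -mulrA mulrCA dvdp_mulr.
rewrite comp_Xn_poly; apply: (@dvdXnM n.+1 m).
- by rewrite addnC leq_add2r.
- exact: comp_diff_dvd.
by apply: dvdXn_pow G1; rewrite mul1n.
Qed.

End Depth.
End Order.
Arguments dvdXn_X {F m n}.

(** * Third powers in characteristic 3 *)

Section Char3.
Variable F : fieldType.
Hypothesis char3 : 3%:R = 0 :> F.
Implicit Types P Q G R : {poly F}.

Lemma poly_char3 : 3%:R = 0 :> {poly F}.
Proof. by rewrite -polyC_natr char3. Qed.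

Lemma cubeB P Q : (P - Q) ^+ 3 = P ^+ 3 - Q ^+ 3.
Proof.
have -> : (P - Q) ^+ 3 = P ^+ 3 - Q ^+ 3 + 3%:R * (P * Q ^+ 2 - P ^+ 2 * Q).
  by ring.
by rewrite poly_char3 mul0r addr0.
Qed.

Lemma comp_diff_cubed G P : comp_diff G (P ^+ 3) = comp_diff G P ^+ 3.
Proof. by rewrite /comp_diff rmorphXn /= cubeB. Qed.

(** [T^3 - 1 = (T - 1)^3]. *)
Lemma comp_diff_iter3 G P :
  comp_diff G (comp_diff G (comp_diff G P)) = ((P \Po G) \Po G) \Po G - P.
Proof.
have key (t x y z : {poly F}) :
    z - y - (y - x) - (y - x - (x - t)) = z - t + 3%:R * (x - y) by ring.
by rewrite /comp_diff !comp_polyB key poly_char3 mul0r addr0.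
Qed.

(** Cubes are moved much further than other series of the same order, because
    [D(P^3) = (D P)^3]; so they behave like constants for [D = comp_diff G]. *)
Lemma comp_diff_cubeM n m r l G P Q : O n.+1 (G - 'X) -> O m P -> O r Q ->
    (l <= 3 * m + 3 * n + r)%N ->
  O l (comp_diff G (P ^+ 3 * Q) - P ^+ 3 * comp_diff G Q).
Proof.
move=> Gn Pm Qr le_l; rewrite comp_diff_M addrK comp_diff_cubed.
apply: (@dvdXnM _ (3 * m + 3 * n) r) => //.
  apply: (@dvdXn_pow _ (m + n)); first lia.
  exact: dvdXn_comp_diff.
apply: dvdXn_comp => //; rewrite -(subrK 'X G) dvdp_add //.
exact: dvdXn_le Gn.
Qed.

Lemma comp_diff_cube n m l G P : O n.+1 (G - 'X) -> O m P ->
    (l <= 3 * m + 3 * n)%N ->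
  O l (comp_diff G (P ^+ 3)).
Proof.
move=> Gn Pm le_l; rewrite comp_diff_cubed.
by apply: (@dvdXn_pow _ (m + n)); [lia|apply: dvdXn_comp_diff].
Qed.

(** The leading terms of [D^3 t], for [D t = a t^(n+1) + b t^(n+2) + ...] with
    [n] congruent to 1 modulo 3.  The exponents [n + 2] and [2n + 1] are
    multiples of 3, so the corresponding terms are lost at the next application
    of [D]; what survives of order [3n + 2] comes from [2ab t^(2n+2)] in [D^2 t].
    The term in [a^4] comes from the square of [D t] in [D (t^2)]; it has order
    at most [3n + 2] only for [n = 1]. *)
Lemma comp_diff_iter3_lead q n a b G : n = (3 * q).+1 ->
    O (n + 3) (G - 'X - a%:P * 'X^(n + 1) - b%:P * 'X^(n + 2)) ->
  O (3 * n + 3) (comp_diff G (comp_diff G (comp_diff G 'X))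
    - ((a ^+ 2 * b *+ 2)%:P * 'X^(3 * n + 2) + (a ^+ 4)%:P * 'X^(4 * n + 1))).
Proof.
move=> En; set R := (X in O _ X) => OR.
pose A := a%:P; pose B := b%:P; pose Y : {poly F} := 'X^q.
have YX i j k : (k = 3 * q * i + j)%N -> 'X^k = (Y ^+ 3) ^+ i * 'X^j.
  by move=> ->; rewrite -!exprM -exprD; congr ('X^_); lia.
have OY i j k : (k <= i * q + j)%N -> O k (Y ^+ i * 'X^j).
  by move=> le_k; rewrite -exprM -exprD dvdXn_X // mulnC.
set D := comp_diff G; pose E := G - 'X.
have EE : E = A * ('X^(n + 1)) + B * 'X^(n + 2) + R by rewrite /E /R /A /B; ring.
have OR2 : O (n + 2) R by apply: (dvdXn_le _ OR); (clear -En; lia).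
have OE1 : O (n + 2) (E - A * 'X^(n + 1)).
  have -> : E - A * 'X^(n + 1) = B * 'X^(n + 2) + R by rewrite EE; ring.
  by rewrite dvdp_add // dvdp_mull.
have OE : O n.+1 E.
  have -> : E = (E - A * 'X^(n + 1)) + A * 'X^(n + 1) by ring.
  apply: dvdp_add; first by apply: (dvdXn_le _ OE1); (clear -En; lia).
  by apply/dvdp_mull/dvdXn_X; (clear -En; lia).
have DX2 : D 'X^2 = E * ('X *+ 2 + E).
  by rewrite /D expr2 comp_diff_M comp_polyX comp_diffX /E; ring.
(* All the terms of [D^2 t] of order less than [2n + 3] are in [C2]. *)
pose C2 := (A ^+ 2 *+ 2) * 'X^(2 * n + 1) + (A * B *+ 2) * 'X^(2 * n + 2)
  + A ^+ 3 * 'X^(3 * n + 1).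
have O2 : O (2 * n + 3) (D E - C2).
  pose R1 := D (Y ^+ 3 * 'X^2) - Y ^+ 3 * D 'X^2.
  have OR1 : O (2 * n + 3) R1.
    by apply: (@comp_diff_cubeM n q 2); rewrite ?dvdXn_X //; (clear -En; lia).
  have OR3 : O (2 * n + 3) (D ((Y * 'X) ^+ 3)).
    apply: (@comp_diff_cube n (q + 1)); rewrite ?exprD ?expr1 ?dvdp_mul //; (clear -En; lia).
  have OR4 : O (2 * n + 3) (D R).
    by apply: (@dvdXn_le _ _ (n + 3 + n)); [(clear -En; lia)|apply: dvdXn_comp_diff OR].
  have -> : D E - C2 = A * R1 + B * D ((Y * 'X) ^+ 3) + D R
     + (A *+ 2) * (Y ^+ 3 * 'X^1) * R
     + (A * Y ^+ 3) * ((E - A * 'X^(n + 1)) * (E + A * 'X^(n + 1))).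
    have ER : R = E - A * (Y ^+ 3 * 'X^2) - B * (Y * 'X) ^+ 3.
      by rewrite EE (@YX 1 2 (n + 1)) ?(@YX 1 3 (n + 2)); [ring|(clear -En; lia)|(clear -En; lia)].
    have -> : D E = A * D (Y ^+ 3 * 'X^2) + B * D ((Y * 'X) ^+ 3) + D R.
      rewrite /D -!comp_diff_C -!comp_diff_D; congr (comp_diff G _); rewrite ER; ring.
    rewrite /R1 DX2 /C2 (@YX 1 2 (n + 1)); last (clear -En; lia).
    rewrite (@YX 2 3 (2 * n + 1)) ?(@YX 2 4 (2 * n + 2)); try (clear -En; lia).
    rewrite (@YX 3 4 (3 * n + 1)); last (clear -En; lia).
    rewrite {3}ER; ring.
  have YO : O n (Y ^+ 3 * 'X^1) by apply: OY; (clear -En; lia).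
  have Y3 : O (n - 1) (Y ^+ 3) by rewrite -exprM dvdXn_X //; (clear -En; lia).
  apply: dvdp_add; [apply: dvdp_add; [apply: dvdp_add; [apply: dvdp_add|]|]|].
  - exact: dvdp_mull.
  - exact: dvdp_mull.
  - by [].
  - rewrite -mulrA dvdp_mull //; apply: (@dvdXnM _ n (n + 3)) => //; (clear -En; lia).
  rewrite -mulrA dvdp_mull //; apply: (@dvdXnM _ (n - 1) (n + 2 + (n + 1))) => //.
    (clear -En; lia).
  apply: (@dvdXnM _ (n + 2) (n + 1)) => //.
  by apply: dvdp_add; [rewrite addn1|rewrite dvdp_mull].
pose R2 := D E - C2.
have -> : D (D (D 'X)) = D C2 + D R2.
  by rewrite /D -comp_diff_D /R2 addrC subrK comp_diffX.
(* [C2] is a combination of cubes and of cubes times [t]. *)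
pose S1 := D ((Y ^+ 2 * 'X) ^+ 3).
pose S2 := D ((Y ^+ 2 * 'X) ^+ 3 * 'X) - (Y ^+ 2 * 'X) ^+ 3 * D 'X.
pose S3 := D ((Y ^+ 3 * 'X) ^+ 3 * 'X) - (Y ^+ 3 * 'X) ^+ 3 * D 'X.
have O1 : O 1 ('X : {poly F}) by rewrite expr1 dvdpp.
have Y2X : O (2 * q + 1) (Y ^+ 2 * 'X) by apply: (@OY 2 1); (clear -En; lia).
have Y3X : O (3 * q + 1) (Y ^+ 3 * 'X) by apply: (@OY 3 1); (clear -En; lia).
have OS1 : O (3 * n + 3) S1 by apply: (@comp_diff_cube n (2 * q + 1)) => //; (clear -En; lia).
have OS2 : O (3 * n + 3) S2.
  by apply: (@comp_diff_cubeM n (2 * q + 1) 1) => //; (clear -En; lia).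
have OS3 : O (3 * n + 3) S3.
  by apply: (@comp_diff_cubeM n (3 * q + 1) 1) => //; (clear -En; lia).
have OS4 : O (3 * n + 3) (D R2).
  by apply: (@dvdXn_le _ _ (2 * n + 3 + n)); [(clear -En; lia)|apply: dvdXn_comp_diff O2].
have -> : D C2 + D R2 - ((a ^+ 2 * b *+ 2)%:P * 'X^(3 * n + 2)
      + (a ^+ 4)%:P * 'X^(4 * n + 1))
  = (A ^+ 2 *+ 2) * S1 + (A * B *+ 2) * S2 + A ^+ 3 * S3 + D R2
    + (A * B *+ 2) * ((Y ^+ 2 * 'X) ^+ 3 * (E - A * 'X^(n + 1)))
    + A ^+ 3 * ((Y ^+ 3 * 'X) ^+ 3 * (E - A * 'X^(n + 1))).
  have -> : D C2 = (A ^+ 2 *+ 2) * S1 + (A * B *+ 2) * D ((Y ^+ 2 * 'X) ^+ 3 * 'X)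
      + A ^+ 3 * D ((Y ^+ 3 * 'X) ^+ 3 * 'X).
    rewrite /S1 /D /A /B -!(rmorphXn, rmorphM, rmorphMn) /= -!comp_diff_C -!comp_diff_D.
    congr (comp_diff G _); rewrite /C2 (@YX 2 3 (2 * n + 1)); last (clear -En; lia).
    rewrite (@YX 2 4 (2 * n + 2)) ?(@YX 3 4 (3 * n + 1)); try (clear -En; lia).
    by rewrite !(rmorphXn, rmorphM, rmorphMn) /= -/A -/B; ring.
  rewrite /S2 /S3 !(rmorphXn, rmorphM, rmorphMn) /= -/A -/B.
  rewrite (@YX 3 5 (3 * n + 2)) ?(@YX 4 5 (4 * n + 1)) ?(@YX 1 2 (n + 1)); try (clear -En; lia).
  rewrite /D comp_diffX -/E; ring.
apply: dvdp_add; [apply: dvdp_add; [apply: dvdp_add; [apply: dvdp_add;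
  [apply: dvdp_add|]|]|]|].
- exact: dvdp_mull.
- exact: dvdp_mull.
- exact: dvdp_mull.
- by [].
- rewrite dvdp_mull //; apply: (@dvdXnM _ ((2 * q + 1) * 3) (n + 2)) => //.
    by (clear -En; lia).
  exact: dvdXn_pow Y2X.
rewrite dvdp_mull //; apply: (@dvdXnM _ ((3 * q + 1) * 3) (n + 2)) => //.
  by (clear -En; lia).
exact: dvdXn_pow Y3X.
Qed.
End Char3.

(** * Commutators of substitutions *)

Section Commutator.
Variable F : fieldType.
Implicit Types P Q G H : {poly F}.

(** [D] acts on leading terms like the derivation [a t^(n+1) d/dt]. *)
Lemma comp_diff_XnE n a G m : (0 < n)%N -> O (n + 2) (G - 'X - a%:P * 'X^(n + 1)) ->
  O (m + n + 1) (comp_diff G 'X^m - (a *+ m)%:P * 'X^(m + n)).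
Proof.
move=> n0; set R := (X in O _ X) => OR.
have EG : G = 'X + a%:P * 'X^(n + 1) + R by rewrite /R; ring.
elim: m => [|m IH].
  by rewrite /comp_diff expr0 comp_polyC subrr mulr0n mul0r subr0 dvdp0.
set S := (X in O _ X) in IH.
have -> : comp_diff G 'X^(m.+1) - (a *+ m.+1)%:P * 'X^(m.+1 + n)
  = S * G + (a *+ m)%:P * ('X^(m + n) * (G - 'X)) + 'X^m * R.
  rewrite [in comp_diff _ _]exprS mulrC comp_diff_M comp_polyX comp_diffX /S EG !exprD !expr1.
  by rewrite mulrSr polyCD exprS; ring.
have E1 : O (n + 1) (G - 'X).
  have -> : G - 'X = a%:P * 'X^(n + 1) + R by rewrite EG; ring.
  by rewrite dvdp_add ?dvdp_mull // (dvdXn_le _ OR) // leq_add2l.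
have OG : O 1 G.
  have -> : G = (G - 'X) + 'X by ring.
  by rewrite dvdp_add ?expr1 // -[X in X %| _]expr1 (dvdXn_le _ E1) // leq_addl.
apply: dvdp_add; first apply: dvdp_add.
- by apply: dvdXnM IH OG; clear; lia.
- apply: dvdp_mull; apply: dvdXnM (dvdXn_X (leqnn (m + n))) E1.
  by clear -n0; lia.
by apply: dvdXnM (dvdXn_X (leqnn m)) OR; clear; lia.
Qed.

(** [F o G - G o F], computed through [(T_G - 1)(F - t) - (T_F - 1)(G - t)]. *)
Lemma comp_commE G H :
  (G \Po H) - (H \Po G) = comp_diff H (G - 'X) - comp_diff G (H - 'X).
Proof. by rewrite /comp_diff !comp_polyB !comp_polyX; ring. Qed.

(** The bracket of the derivations [a t^(i+1) d/dt] and [b t^(j+1) d/dt]. *)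
Lemma comp_comm_lead i j a b G H : (0 < i)%N -> (0 < j)%N ->
    O (i + 2) (G - 'X - a%:P * 'X^(i + 1)) ->
    O (j + 2) (H - 'X - b%:P * 'X^(j + 1)) ->
  O (i + j + 2) ((G \Po H) - (H \Po G)
    - (a * b * (i%:R - j%:R))%:P * 'X^(i + j + 1)).
Proof.
move=> i0 j0 OG OH.
have := comp_diff_XnE (i + 1) j0 OH; have := comp_diff_XnE (j + 1) i0 OG.
move: OG OH; set RG := (X in O _ X) => OG; set RH := (X in O _ X) => OH.
have OE n c P : O (n + 2) (P - 'X - c%:P * 'X^(n + 1)) -> O n.+1 (P - 'X).
  set R := (X in O _ X) => OP.
  have -> : P - 'X = c%:P * 'X^(n + 1) + R by rewrite /R; ring.
  by rewrite dvdp_add ?dvdp_mull ?dvdXn_X ?addn1 // (dvdXn_le _ OP) // addn2.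
set S := (X in O _ X) => OS; set T := (X in O _ X) => OT.
have EG : G - 'X = a%:P * 'X^(i + 1) + RG by rewrite /RG; ring.
have EH : H - 'X = b%:P * 'X^(j + 1) + RH by rewrite /RH; ring.
have {OE} [OE1 OE2] := (OE _ _ _ OG, OE _ _ _ OH).
clearbody RG RH.
rewrite comp_commE {1}EG {1}EH !comp_diff_D !comp_diff_C.
have -> : a%:P * comp_diff H 'X^(i + 1) + comp_diff H RG
    - (b%:P * comp_diff G 'X^(j + 1) + comp_diff G RH)
    - (a * b * (i%:R - j%:R))%:P * 'X^(i + j + 1)
  = a%:P * T - b%:P * S + comp_diff H RG - comp_diff G RH.
  have -> : S = comp_diff G 'X^(j + 1) - (a *+ (j + 1))%:P * 'X^(i + j + 1).
    by rewrite /S; congr (_ - _ * 'X^_); clear; lia.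
  have -> : T = comp_diff H 'X^(i + 1) - (b *+ (i + 1))%:P * 'X^(i + j + 1).
    by rewrite /T; congr (_ - _ * 'X^_); clear; lia.
  move: 'X^(i + j + 1) => M; rewrite !(polyCM, polyCB, polyCMn) polyC1.
  rewrite !mulrnDr !mulr1n -[a%:P *+ j]mulr_natr -[b%:P *+ i]mulr_natr.
  ring.
apply: dvdp_add; first apply: dvdp_add; first apply: dvdp_add;
  rewrite ?dvdpNr.
- by apply: dvdp_mull; apply: (dvdXn_le _ OT); clear; lia.
- by apply: dvdp_mull; apply: (dvdXn_le _ OS); clear; lia.
- by apply: (dvdXn_le _ (dvdXn_comp_diff OE2 OG)); clear; lia.
by apply: (dvdXn_le _ (dvdXn_comp_diff OE1 OH)); clear; lia.
Qed.

Hypothesis char3 : 3%:R = 0 :> F.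

(** When [n] is congruent to 1 modulo 3 the previous lemma, with [i = 1] and
    [j = n], gives no leading term, and the next coefficient is needed.  The term
    [d t^(n+2)] of [H] has exponent divisible by 3, so only its product with
    [a t^2] counts; the term in [a^2] comes from the square of [G - t]. *)
Lemma comp_comm_lead3 q n a b c d G H : n = (3 * q).+1 -> (0 < q)%N ->
    O 4 (G - 'X - a%:P * 'X^2 - b%:P * 'X^3) ->
    O (n + 3) (H - 'X - c%:P * 'X^(n + 1) - d%:P * 'X^(n + 2)) ->
  O (n + 4) ((G \Po H) - (H \Po G)
     - (a * d *+ 2 - c * (b *+ 2 + a ^+ 2))%:P * 'X^(n + 3)).
Proof.
move=> En q0; set R := (X in O _ X) => OR; set S := (X in O _ X) => OS.
pose Y : {poly F} := 'X^q.
have YX j k : (k = 3 * q + j)%N -> 'X^k = Y ^+ 3 * 'X^j.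
  by move=> ->; rewrite -!exprM -exprD; congr ('X^_); clear; lia.
pose E := G - 'X; pose K := H - 'X.
have EE : E = a%:P * 'X^2 + b%:P * 'X^3 + R by rewrite /R /E; ring.
have EK : K = c%:P * 'X^(n + 1) + d%:P * 'X^(n + 2) + S by rewrite /S /K; ring.
clearbody R S.
have OE : O 2 E.
  rewrite EE; apply: dvdp_add; first apply: dvdp_add.
  - by apply/dvdp_mull/dvdXn_X.
  - by apply/dvdp_mull/dvdXn_X.
  by apply: (dvdXn_le _ OR).
have OK : O n.+1 K.
  rewrite EK; apply: dvdp_add; first apply: dvdp_add.
  - by apply/dvdp_mull/dvdXn_X; clear; lia.
  - by apply/dvdp_mull/dvdXn_X; clear; lia.
  by apply: (dvdXn_le _ OS); clear; lia.
pose U1 := comp_diff G (Y ^+ 3 * 'X^2) - Y ^+ 3 * comp_diff G 'X^2.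
pose U2 := comp_diff G ((Y * 'X) ^+ 3).
pose U3 := comp_diff H ('X ^+ 3).
have O1 : O 1 ('X : {poly F}) by rewrite expr1 dvdpp.
have OY : O q Y by exact: dvdpp.
have OYX : O (q + 1) (Y * 'X) by apply: dvdXnM OY O1.
have OU1 : O (n + 4) U1.
  by apply: (@comp_diff_cubeM _ char3 1 q 2) => //; rewrite ?dvdXn_X //; clear -En q0; lia.
have OU2 : O (n + 4) U2.
  by apply: (@comp_diff_cube _ char3 1 (q + 1)) => //; clear -En q0; lia.
have OU3 : O (n + 4) U3.
  by apply: (@comp_diff_cube _ char3 n 1) => //; clear -En q0; lia.
have OU4 : O (n + 4) (comp_diff H R).
  by apply: (dvdXn_le _ (dvdXn_comp_diff OK OR)); clear -En q0; lia.
have OU5 : O (n + 4) (comp_diff G S).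
  by apply: (dvdXn_le _ (@dvdXn_comp_diff _ 1 _ OE _ _ OS)); clear -En q0; lia.
rewrite comp_commE -/E -/K.
have -> : comp_diff H E = a%:P * (K * ('X *+ 2 + K)) + b%:P * U3 + comp_diff H R.
  have -> : K * ('X *+ 2 + K) = comp_diff H 'X^2.
    by rewrite expr2 comp_diff_M comp_polyX comp_diffX /K; ring.
  by rewrite /U3 EE !comp_diff_D !comp_diff_C.
have -> : comp_diff G K = c%:P * (U1 + Y ^+ 3 * (E * ('X *+ 2 + E))) + d%:P * U2
     + comp_diff G S.
  have -> : E * ('X *+ 2 + E) = comp_diff G 'X^2.
    by rewrite expr2 comp_diff_M comp_polyX comp_diffX /E; ring.
  rewrite /U1 subrK /U2 -!comp_diff_C -!comp_diff_D EK; congr (comp_diff G _).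
  by rewrite (@YX 2 (n + 1)) ?(@YX 3 (n + 2)) //; [ring|clear -En; lia..].
have -> : a%:P * (K * ('X *+ 2 + K)) + b%:P * U3 + comp_diff H R -
   (c%:P * (U1 + Y ^+ 3 * (E * ('X *+ 2 + E))) + d%:P * U2 + comp_diff G S) -
   (a * d *+ 2 - c * (b *+ 2 + a ^+ 2))%:P * 'X^(n + 3)
  = b%:P * U3 + comp_diff H R - c%:P * U1 - d%:P * U2 - comp_diff G S
   + (a%:P *+ 2 * ('X * S) + a%:P * (K * K)
     - c%:P * (Y ^+ 3 * ('X *+ 2 * R + (E - a%:P * 'X^2) * (E + a%:P * 'X^2)))).
  rewrite !(polyCM, polyCB, polyCMn, polyCD, rmorphXn) /=.
  have ES : S = K - c%:P * (Y ^+ 3 * 'X^2) - d%:P * (Y ^+ 3 * 'X^3).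
    by rewrite EK (@YX 2 (n + 1)) ?(@YX 3 (n + 2)) //; [ring|clear -En; lia..].
  rewrite (@YX 4 (n + 3)); last by clear -En; lia.
  have ER : R = E - a%:P * 'X^2 - b%:P * 'X^3 by rewrite EE; ring.
  rewrite {3}ER {3}ES; ring.
have OE2 : O 3 (E - a%:P * 'X^2).
  have -> : E - a%:P * 'X^2 = b%:P * 'X^3 + R by rewrite EE; ring.
  apply: dvdp_add; first by apply/dvdp_mull/dvdXn_X.
  by apply: (dvdXn_le _ OR).
have OY3 : O (n - 1) (Y ^+ 3) by apply: dvdXn_pow OY; clear -En; lia.
apply: dvdp_add.
  apply: dvdp_add; last by rewrite dvdpNr.
  apply: dvdp_add; last by rewrite dvdpNr dvdp_mull.
  apply: dvdp_add; last by rewrite dvdpNr dvdp_mull.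
  by apply: dvdp_add; first rewrite dvdp_mull.
apply: dvdp_add; first apply: dvdp_add; rewrite ?dvdpNr; apply: dvdp_mull.
- by apply: dvdXnM O1 OS; clear; lia.
- by apply: (dvdXnM _ OK OK); clear -En q0; lia.
apply: (@dvdXnM _ (n - 1) 5) OY3 _; first by clear -En q0; lia.
apply: dvdp_add.
  by rewrite mulr2n mulrDl; apply: dvdp_add; apply: dvdXnM O1 OR.
apply: (@dvdXnM _ 3 2) => //; apply: dvdp_add => //.
by apply/dvdp_mull/dvdXn_X.
Qed.
End Commutator.

(** * Leading coefficients in the Nottingham group *)

Lemma F3_char3 : 3%:R = 0 :> 'F_3.
Proof. exact/val_inj. Qed.

Section Coefficients.
Implicit Types f g s c x y : N.

Lemma N_coefE n f i : f \in 'N_n -> (i <= n)%N -> f i = (i == 1)%:R.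
Proof. by move=> /nottingham_subP fn le_in; rewrite fn. Qed.

Lemma N_P n f : reflect (forall i, (1 < i <= n)%N -> f i = 0) (f \in 'N_n).
Proof.
apply: (iffP idP) => [fn i /andP[i1 le_in]|f0].
  by rewrite (N_coefE fn le_in) gtn_eqF.
apply/nottingham_subP => -[|[|i]] lt_in; first exact: coefs0.
  exact: coefs1.
by rewrite f0.
Qed.

Lemma N1 f : f \in 'N_1.
Proof. by apply/N_P => -[|[|i]]. Qed.

Lemma N_succ n f : (0 < n)%N ->
  (f \in 'N_n.+1) = (f \in 'N_n) && (f n.+1 == 0).
Proof.
move=> n0; apply/N_P/andP => [f0|[/N_P f0 /eqP fn] i /andP[i1]].
  split; last by rewrite f0 //= ltnS n0 leqnn.
  by apply/N_P=> i /andP[i1 le_in]; rewrite f0 // i1 ltnW.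
by rewrite leq_eqVlt => /predU1P[->//|lt_in]; rewrite f0 // i1.
Qed.

Lemma N_le m n f : (m <= n)%N -> f \in 'N_n -> f \in 'N_m.
Proof.
move=> le_mn /N_P f0; apply/N_P=> i /andP[i1 le_im].
by rewrite f0 // i1 (leq_trans le_im).
Qed.

Lemma NM n f g : f \in 'N_n -> g \in 'N_n -> (f * g)%g \in 'N_n.
Proof.
move=> /nottingham_subP fn /nottingham_subP gn; apply/nottingham_subP => i lt_in.
by rewrite -(mulg1 1%g); apply: nottingham_mul_congr lt_in.
Qed.

Lemma NX n f m : f \in 'N_n -> (f ^+ m)%g \in 'N_n.
Proof.
by move=> fn; elim: m => [|m IH]; [apply/nottingham_subP|rewrite expgS NM].
Qed.

Lemma trunc_dvd K f m (P : {poly 'F_3}) : (m <= K)%N ->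
    (forall i, (i < m)%N -> f i = P`_i) ->
  O m (tr K f - P).
Proof.
move=> le_mK fP; apply/dvdXn_subP => i lt_im.
by rewrite coef_trunc (leq_trans lt_im) ?fP.
Qed.

Lemma N_trunc K n f : (n < K)%N -> (0 < n)%N -> f \in 'N_n ->
  O n.+1 (tr K f - 'X).
Proof.
move=> lt_nK n0 fn; apply: trunc_dvd => // i lt_in.
by rewrite (N_coefE fn) // coefX.
Qed.

Lemma N_trunc1 K n f : (n + 1 < K)%N -> (0 < n)%N -> f \in 'N_n ->
  O (n + 2) (tr K f - 'X - (f (n + 1)%N)%:P * 'X^(n + 1)).
Proof.
move=> lt_nK n0 fn; rewrite -addrA -opprD; apply: trunc_dvd => [|i lt_in].
  by clear -lt_nK; lia.
rewrite coefD coefX coefCM coefXn.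
have [->|ne_in] := eqVneq i (n + 1)%N.
  by rewrite mulr1 (_ : (n + 1 == 1) = false)%N ?add0r //; clear -n0; lia.
by rewrite mulr0 addr0 (N_coefE fn) //; move/eqP: ne_in lt_in; clear; lia.
Qed.

Lemma N_trunc2 K n f : (n + 2 < K)%N -> (0 < n)%N -> f \in 'N_n ->
  O (n + 3) (tr K f - 'X - (f (n + 1)%N)%:P * 'X^(n + 1)
     - (f (n + 2)%N)%:P * 'X^(n + 2)).
Proof.
move=> lt_nK n0 fn; rewrite -!addrA -!opprD; apply: trunc_dvd => [|i lt_in].
  by clear -lt_nK; lia.
rewrite !coefD coefX !coefCM !coefXn.
have [->|ne_in] := eqVneq i (n + 1)%N.
  rewrite mulr1 (_ : (n + 1 == 1) = false)%N; last by clear -n0; lia.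
  rewrite (_ : (n + 1 == n + 2) = false)%N; last by clear; lia.
  by rewrite mulr0 add0r addr0.
have [->|ne_in2] := eqVneq i (n + 2)%N.
  rewrite mulr1 mulr0 (_ : (n + 2 == 1) = false)%N; last by clear; lia.
  by rewrite !add0r.
rewrite !mulr0 !addr0 (N_coefE fn) //.
by move/eqP: ne_in; move/eqP: ne_in2; move: lt_in; clear; lia.
Qed.

Lemma trunc0 K f : (tr K f)`_0 = 0.
Proof. by rewrite coef_trunc coefs0 if_same. Qed.

Lemma coef_mul K f g i : (i < K)%N -> (f * g)%g i = (tr K f \Po tr K g)`_i.
Proof. by move=> lt_iK; apply: series_compE => //; apply: coefs0. Qed.

Lemma coef_cube K f i : (i < K)%N ->
  (f ^+ 3)%g i = (((tr K f) \Po (tr K f)) \Po (tr K f))`_i.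
Proof.
move=> lt_iK; rewrite (_ : f ^+ 3 = f * (f * f))%g // (@coef_mul K) //.
rewrite -comp_polyA; apply: (@comp_poly_congr _ K) => // [|j lt_jK].
  exact: trunc0.
by rewrite coef_trunc lt_jK (@coef_mul K).
Qed.

(** With [D = comp_diff c], [f(c) - f - (c - t) = D (f - t)] has order at least
    [n + 2]. *)
Lemma coef_mul_sub n f c i : (0 < n)%N -> c \in 'N_n -> (i <= n + 1)%N ->
  (f * c)%g i = f i + (c i - (i == 1)%:R).
Proof.
move=> n0 cn le_in; pose K := (n + 3)%N.
have lt_iK : (i < K)%N by rewrite /K; clear -le_in; lia.
rewrite (coef_mul _ _ lt_iK).
have Oc : O n.+1 (tr K c - 'X) by apply: N_trunc => //; rewrite /K; clear; lia.
have Of : O 2 (tr K f - 'X) by apply: (@N_trunc K 1) (N1 f); rewrite // /K addn3.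
have -> : tr K f \Po tr K c = comp_diff (tr K c) (tr K f - 'X) + tr K f + (tr K c - 'X).
  by rewrite /comp_diff comp_polyB comp_polyX; ring.
have OD : O (n + 2) (comp_diff (tr K c) (tr K f - 'X)).
  by apply: (dvdXn_le _ (dvdXn_comp_diff Oc Of)); rewrite addnC.
rewrite coefD coefB coefX coefD (dvdXn_coef OD) ?add0r ?coef_trunc ?lt_iK //.
by clear -le_in; lia.
Qed.

Lemma coef_lead_mul n f g : (0 < n)%N -> f \in 'N_n -> g \in 'N_n ->
  (f * g)%g n.+1 = f n.+1 + g n.+1.
Proof.
move=> n0 fn gn; rewrite (coef_mul_sub _ n0 gn) ?addn1 // eqSS.
by rewrite (gtn_eqF n0) subr0.
Qed.

Lemma coef_lead_exp n f m : (0 < n)%N -> f \in 'N_n ->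
  (f ^+ m)%g n.+1 = f n.+1 *+ m.
Proof.
move=> n0 fn; elim: m => [|m IH]; first by rewrite /= /series_id gtn_eqF.
by rewrite expgS coef_lead_mul ?NX // IH mulrS.
Qed.

Lemma cube_sub n f : (0 < n)%N -> f \in 'N_n -> (f ^+ 3)%g \in 'N_n.+1.
Proof.
move=> n0 fn; rewrite N_succ // NX // coef_lead_exp //.
by rewrite -mulr_natr F3_char3 mulr0 eqxx.
Qed.

Lemma exp3_sub n f : (f ^+ (3 ^ n))%g \in 'N_n.+1.
Proof.
elim: n => [|n IH]; first exact: N1.
by rewrite expnSr expgM cube_sub.
Qed.

(** The correction by the square makes [phi] a homomorphism. *)
Definition phi f : 'F_3 := f 3%N - f 2%N ^+ 2.

Lemma coef2M f g : (f * g)%g 2%N = f 2%N + g 2%N.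
Proof. by rewrite (@coef_lead_mul 1) ?N1. Qed.

Lemma phiM f g : phi (f * g)%g = phi f + phi g.
Proof.
suff -> : phi (f * g)%g = f 3%N + g 3%N + 2%:R * f 2%N * g 2%N - (f 2%N + g 2%N) ^+ 2.
  by rewrite /phi; ring.
rewrite /phi coef2M; congr (_ - _).
rewrite (@coef_mul 4) //.
set F := tr 4 f; set G := tr 4 g.
have OG := @N_trunc 4 1 g isT isT (N1 g).
have OF := @N_trunc1 4 1 f isT isT (N1 f).
have OG1 := @comp_diff_XnE _ 1 _ _ 2 isT (@N_trunc1 4 1 g isT isT (N1 g)).
have -> : F \Po G = (f 2%N)%:P * comp_diff G 'X^2
     + comp_diff G (F - 'X - (f 2%N)%:P * 'X^2) + F + (G - 'X).
  by rewrite -comp_diff_C -comp_diff_D /comp_diff comp_polyD !comp_polyB comp_polyX; ring.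
rewrite coefD coefB coefX coefD coefD coefCM.
rewrite (dvdXn_coef (dvdXn_comp_diff OG OF)) // !coef_trunc /=.
have /eqP := dvdXn_coef OG1 (isT : (3 < 2 + 1 + 1)%N).
rewrite coefB coefCM coefXn /= mulr1 subr_eq0 => /eqP ->.
by rewrite mulr2n; ring.
Qed.

(** The indicator functions keep together the two cases [n = 1], where
    [3 * n + 2 = 4 * n + 1], and [n > 1], where the last term is [0]. *)
Lemma coef_cube_lead q n f i : n = (3 * q).+1 -> f \in 'N_n -> (i < 3 * n + 3)%N ->
  (f ^+ 3)%g i = (i == 1)%:R
    + (f (n + 1)%N ^+ 2 * f (n + 2)%N *+ 2) * (i == 3 * n + 2)%:R
    + f (n + 1)%N ^+ 4 * (i == 4 * n + 1)%:R.
Proof.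
move=> En fn lt_i; pose K := (3 * n + 3)%N.
have K2 : (n + 2 < K)%N by rewrite /K; clear; lia.
have n0 : (0 < n)%N by rewrite En.
have OC := comp_diff_iter3_lead F3_char3 En (N_trunc2 K2 n0 fn).
rewrite (coef_cube _ lt_i); have /eqP := dvdXn_coef OC lt_i.
rewrite comp_diff_iter3 ?comp_polyX; last exact: F3_char3.
rewrite coefB coefB coefD !coefCM !coefXn coefX subr_eq0 subr_eq => /eqP ->.
by rewrite addrC addrA.
Qed.

(** This is the vanishing of the coefficient of [t^(n+3)] in [f(s) - s(f)].  It
    lets one read off from a high power of [f] the maximal subgroup of [f]. *)
Lemma comm_lead q n f s : n = (3 * q).+1 -> (0 < q)%N -> s \in 'N_n ->
  commute f s -> f 2%N * s (n + 2)%N = s (n + 1)%N * phi f.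
Proof.
move=> En q0 sn cfs; pose K := (n + 4)%N.
have K2 : (n + 2 < K)%N by rewrite /K; clear; lia.
have K1 : (1 + 2 < K)%N by rewrite /K; clear -En q0; lia.
have n0 : (0 < n)%N by rewrite En.
have lt_K : (n + 3 < n + 4)%N by clear; lia.
have OC := comp_comm_lead3 F3_char3 En q0 (N_trunc2 K1 isT (N1 f)) (N_trunc2 K2 n0 sn).
have /eqP := dvdXn_coef OC lt_K.
rewrite coefB coefB coefCM coefXn eqxx mulr1.
rewrite -!(coef_mul _ _ lt_K) cfs subrr sub0r oppr_eq0 subr_eq0 => /eqP E.
rewrite /phi; set a := f 2%N in E *; set b := f 3%N in E *.
set c := s (n + 1)%N in E *; set d := s (n + 2)%N in E *.
have -> : a * d = 3%:R * (a * d) - a * d *+ 2 by ring.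
rewrite E F3_char3 mul0r sub0r.
have -> : c * (b - a ^+ 2) = 3%:R * (c * b) - c * (b *+ 2 + a ^+ 2) by ring.
by rewrite F3_char3 mul0r sub0r.
Qed.

Lemma coef_comm i j x y l : (0 < i)%N -> (0 < j)%N -> x \in 'N_i -> y \in 'N_j ->
  (l < i + j + 2)%N -> (x * y)%g l = (y * x)%g l
    + x (i + 1)%N * y (j + 1)%N * (i%:R - j%:R) * (l == i + j + 1)%:R.
Proof.
move=> i0 j0 xi yj lt_l; pose K := (i + j + 2)%N.
have Ki : (i + 1 < K)%N by rewrite /K; clear -j0; lia.
have Kj : (j + 1 < K)%N by rewrite /K; clear -i0; lia.
have /eqP := dvdXn_coef (comp_comm_lead i0 j0 (N_trunc1 Ki i0 xi) (N_trunc1 Kj j0 yj)) lt_l.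
rewrite coefB coefB coefCM coefXn -!(coef_mul _ _ lt_l) subr_eq0 subr_eq => /eqP ->.
by rewrite addrC.
Qed.

Lemma N_commg i j x y : (0 < i)%N -> (0 < j)%N -> x \in 'N_i -> y \in 'N_j ->
  [~ x, y]%g \in 'N_(i + j).
Proof.
move=> i0 j0 xi yj.
have -> : [~ x, y]%g = ((y * x)^-1 * (x * y))%g by rewrite (commgC x) mulKg.
apply/nottingham_eqmodP => l lt_l.
rewrite (coef_comm i0 j0 xi yj); last by clear -lt_l; lia.
rewrite (_ : (l == i + j + 1)%N = false) ?mulr0 ?addr0 //.
by clear -lt_l; lia.
Qed.

Lemma N_commg_lead i j x y : (0 < i)%N -> (0 < j)%N -> x \in 'N_i -> y \in 'N_j ->
  [~ x, y]%g (i + j).+1 = x (i + 1)%N * y (j + 1)%N * (i%:R - j%:R).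
Proof.
move=> i0 j0 xi yj; have cn := N_commg i0 j0 xi yj.
have lt_l : ((i + j).+1 < i + j + 2)%N by clear; lia.
have := coef_comm i0 j0 xi yj lt_l.
have le_l : ((i + j).+1 <= i + j + 1)%N by rewrite addn1.
rewrite (commgC x) (coef_mul_sub _ _ cn le_l) ?addn_gt0 ?i0 //.
rewrite (_ : ((i + j).+1 == i + j + 1)%N = true); last by clear; lia.
rewrite (_ : ((i + j).+1 == 1)%N = false); last by clear -i0; lia.
by rewrite mulr1 subr0 => /addrI.
Qed.

(** When [n] is congruent to 1 modulo 3, commutators of [N_n] with [N] are in
    [N_(n+2)] instead of just [N_(n+1)], because the coefficient [n - 1] vanishes:
    conjugation preserves two coefficients instead of one. *)
Lemma conj_lead q n k s s' g i : n = (3 * q).+1 -> (n + 2 <= k)%N -> s \in 'N_n ->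
  nottingham_eqmod k (s ^ g)%g s' -> (i < n + 3)%N -> s' i = s i.
Proof.
move=> En le_nk sn /nottingham_eqmodP es lt_i; rewrite -es; last first.
  by clear -lt_i le_nk; lia.
have n0 : (0 < n)%N by rewrite En.
rewrite conjgE -[in RHS](mulKg g s).
have sg j : (j < n + 3)%N -> (s * g)%g j = (g * s)%g j.
  move=> lt_j; rewrite (coef_comm n0 (isT : (0 < 1)%N) sn (N1 g)); last first.
    by clear -lt_j; lia.
  rewrite (_ : n%:R - 1%:R = 0) ?mulr0 ?mul0r ?addr0 //.
  by rewrite En mulrSr addrK natrM F3_char3 mul0r.
by move: i lt_i; apply: nottingham_mul_congr.
Qed.

Lemma nottingham_zS m : nottingham_z 3 m.+1 = (3 * nottingham_z 3 m).-1.
Proof.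
suff H n : (\sum_(1 <= i < n.+2) 3 ^ i = 3 * (\sum_(1 <= i < n.+1) 3 ^ i) + 3)%N.
  by rewrite /nottingham_z H; clear; lia.
elim: n => [|n IH]; first by rewrite big_nat1 big_geq.
by rewrite big_nat_recr // [in RHS]big_nat_recr //= IH (expnS 3 n.+1); clear; lia.
Qed.

Lemma nottingham_z0 : nottingham_z 3 0 = 2.
Proof. by rewrite /nottingham_z big_geq. Qed.

Lemma nottingham_z_mod m : exists q, nottingham_z 3 m = (3 * q).+2.
Proof.
elim: m => [|m [q IH]]; first by exists 0%N; rewrite nottingham_z0.
by exists (3 * q).+1; rewrite nottingham_zS IH; clear; lia.
Qed.

Lemma nottingham_z_ge m : (m + 2 <= nottingham_z 3 m)%N.
Proof.
elim: m => [|m IH]; first by rewrite nottingham_z0.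
by rewrite nottingham_zS; move: IH; clear; lia.
Qed.

(** The step from [n = z_m - 1] to [3n + 1 = z_(m+1) - 1] multiplies the leading
    coefficient [A] by [- A B], or by [- A phi f] for [n = 1]; and [B] is not zero
    since [f] commutes with its powers. *)
Lemma exp3_depth m f : f 2%N != 0 -> phi f != 0 ->
  (f ^+ (3 ^ m))%g \in 'N_(nottingham_z 3 m).-1
    /\ (f ^+ (3 ^ m))%g (nottingham_z 3 m) != 0.
Proof.
move=> a0 p0; elim: m => [|m [IHn IH0]].
  by rewrite nottingham_z0 N1.
have [q Ez] := nottingham_z_mod m.
rewrite nottingham_zS expnSr expgM; set s := (f ^+ (3 ^ m))%g in IHn IH0 *.
have En : (nottingham_z 3 m).-1 = (3 * q).+1 by rewrite Ez.
set n := (nottingham_z 3 m).-1 in IHn En.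
have Ez' : nottingham_z 3 m = (n + 1)%N by rewrite En Ez addn1.
have Ez2 : ((3 * nottingham_z 3 m).-1 = 3 * n + 2)%N by rewrite Ez' En; clear; lia.
rewrite Ez2 => {Ez2}; rewrite Ez' in IH0.
split.
  apply/nottingham_subP => i lt_i; rewrite (coef_cube_lead En IHn).
    rewrite (_ : (i == 3 * n + 2)%N = false); last by clear -lt_i; lia.
    rewrite (_ : (i == 4 * n + 1)%N = false); last by clear -lt_i En; lia.
    by rewrite !mulr0 !addr0.
  by clear -lt_i; lia.
rewrite (coef_cube_lead En IHn); last by clear; lia.
rewrite eqxx mulr1 (_ : (3 * n + 2 == 1)%N = false) ?add0r; last by clear; lia.
set A := s (n + 1)%N in IH0 *; set B := s (n + 2)%N.
have [q0|q_gt0] := posnP q.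
  have Em : m = 0%N.
    by move: (nottingham_z_ge m) Ez; rewrite q0; clear; lia.
  rewrite En q0 /= mulr1 (_ : _ + _ = A ^+ 2 * (3%:R * B - (B - A ^+ 2))); last by ring.
  rewrite F3_char3 mul0r sub0r mulf_neq0 ?expf_neq0 // oppr_eq0.
  by rewrite /A /B /s Em En q0.
rewrite (_ : (3 * n + 2 == 4 * n + 1)%N = false); last first.
  by clear -En q_gt0; lia.
rewrite mulr0 addr0 -mulr_natr mulf_neq0 // mulf_neq0 ?expf_neq0 //.
have E : f 2%N * B = A * phi f.
  by apply: (comm_lead En q_gt0 IHn); apply: commuteX.
by apply: contraTneq (mulf_neq0 IH0 p0) => B0; rewrite -E B0 mulr0 eqxx.
Qed.

End Coefficients.

(** * Cyclic subgroups of finite groups *)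

Section CyclicIntersections.
Local Open Scope group_scope.
Implicit Type gT : finGroupType.

(** A cyclic [p]-group has only one subgroup of order [p]. *)
Lemma cycle_socle gT p e (x y : gT) : prime p -> x ^+ (p ^ e.+1) = 1 ->
  y \in <[x]> -> y != 1 -> x ^+ (p ^ e) \in <[y]>.
Proof.
move=> pr_p xp yx y1; have [->|x1] := eqVneq (x ^+ (p ^ e)) 1; first exact: group1.
have oxe : #[x ^+ (p ^ e)] = p.
  by apply: nt_prime_order => //; rewrite -expgM -expnSr.
have : (#[y] %| p ^ e.+1)%N.
  by apply: dvdn_trans (order_dvdG yx) _; rewrite order_dvdn xp.
case/(dvdn_pfactor _ _ pr_p) => -[|d] _ oy.
  by rewrite -order_eq1 oy in y1.
have oyd : #[y ^+ (p ^ d)] = p.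
  by rewrite orderXdiv oy ?dvdn_exp2l // expnS mulnK // expn_gt0 prime_gt0.
have ->: x ^+ (p ^ e) \in <[y]> = (<[x ^+ (p ^ e)]> \subset <[y]>).
  by rewrite cycle_subG.
have /eqP -> : <[x ^+ (p ^ e)]> == <[y ^+ (p ^ d)]>.
  rewrite (eq_subG_cyclic (cycle_cyclic x)) ?cycle_subG ?mem_cycle ?groupX //.
  by rewrite -!orderE oxe oyd.
exact: cycleX.
Qed.

Lemma beauville_sigma_TI gT (x1 y1 x2 y2 : gT) :
    {in [:: x1; y1; x1 * y1] & [:: x2; y2; x2 * y2],
      forall a b g, <[a]> :&: <[b]> :^ g = 1} ->
  beauville_sigma [set: gT] x1 y1 :&: beauville_sigma [set: gT] x2 y2 = 1.
Proof.
have sigmaP (x y z : gT) : z \in beauville_sigma [set: gT] x y ->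
    exists2 a, a \in [:: x; y; x * y] & exists g, z \in <[a]> :^ g.
  by case/bigcupP=> g _; rewrite !inE -orbA => /or3P[zg|zg|zg];
    [exists x|exists y|exists (x * y)]; rewrite ?inE ?eqxx ?orbT //; exists g.
have sigma1 (x y : gT) : 1 \in beauville_sigma [set: gT] x y.
  by apply/bigcupP; exists 1; rewrite ?inE // conjsg1 group1.
move=> TI; apply/eqP; rewrite eqEsubset; apply/andP; split; last first.
  by apply/subsetP => z /set1P ->; rewrite inE !sigma1.
apply/subsetP => z /setIP[] /sigmaP[a a_in [g zg]] /sigmaP[b b_in [h zh]].
have /setP/(_ (z ^ g^-1)) := TI a b a_in b_in (h * g^-1).
rewrite in_setI -mem_conjg zg conjsgM memJ_conjg zh set1gE in_set1 conjg_eq1.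
by move=> /= /esym/eqP ->; apply/set1P.
Qed.

End CyclicIntersections.

(** * The quotients of the Nottingham group *)

Lemma F3_cases (x : 'F_3) : [\/ x = 0, x = 1 | x = -1].
Proof.
by case: x => -[|[|[|i]]] // lt_i; [apply: Or31|apply: Or32|apply: Or33];
  apply/val_inj.
Qed.

Section Quotient.
Variable k : nat.
Local Notation Q := (nottingham_quotient 3 k).
Implicit Types f g h x y : N.

Definition pr f : Q := \pi_Q f.

Lemma prP f g : reflect (pr f = pr g) (nottingham_eqmod k f g).
Proof. exact: nottingham_quotientP. Qed.

Lemma prM : {morph pr : f g / (f * g)%g}.
Proof. exact: nottingham_piM. Qed.

Lemma pr_eq1 f : (pr f == 1%g) = (f \in 'N_k).
Proof. exact: nottingham_pi_eq1. Qed.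

Lemma pr1 : pr 1%g = 1%g. Proof. by []. Qed.

Lemma prV : {morph pr : f / (f^-1)%g}.
Proof. by move=> f; apply: (mulgI (pr f)); rewrite -prM !mulgV. Qed.

Lemma prX f n : pr (f ^+ n)%g = (pr f ^+ n)%g.
Proof. by elim: n => [|n IH]; rewrite ?pr1 // !expgS prM IH. Qed.

Lemma prJ f g : pr (f ^ g)%g = (pr f ^ pr g)%g.
Proof. by rewrite !conjgE !prM prV. Qed.

Lemma pr_surj (a : Q) : exists f, a = pr f.
Proof. by exists (generic_quotient.repr a); rewrite /pr reprK. Qed.

(** It is enough to test the generator [f^(3^e)] of the smallest nontrivial
    subgroup of [<f>]. *)
Lemma pr_cycle_TI e f g : (f ^+ (3 ^ e.+1))%g \in 'N_k ->
    (forall h j, ~~ nottingham_eqmod k ((f ^+ (3 ^ e)) ^ h)%g (g ^+ j)%g) ->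
  forall b : Q, (<[pr f]> :&: <[pr g]> :^ b = 1)%g.
Proof.
move=> fe neq b; apply/eqP/negP => /negP ntI.
case/trivgPn: ntI => z /setIP[zf zg] z1.
have pe1 : (pr f ^+ (3 ^ e.+1))%g = 1%g by apply/eqP; rewrite -prX pr_eq1.
have /cycleP[i Ei] : (pr f ^+ (3 ^ e) \in <[z]>)%g by exact: cycle_socle pe1 zf z1.
have [h Eh] := pr_surj b^-1%g.
have /cycleP[j Ej] : (z ^ b^-1 \in <[pr g]>)%g by rewrite -mem_conjg.
have /negP[] := neq h (j * i)%N; apply/prP.
by rewrite prJ !prX expgM Ei -Ej -Eh conjXg.
Qed.

Definition abel f : 'F_3 * 'F_3 := (f 2%N, phi f).

Lemma abelM : {morph abel : f g / (f * g)%g >-> f + g}.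
Proof. by move=> f g; rewrite /abel coef2M phiM. Qed.

Lemma abel1 : abel 1%g = 0.
Proof. by apply: (addrI (abel 1%g)); rewrite -abelM mulg1 addr0. Qed.

Lemma abelV f : abel f^-1%g = - abel f.
Proof. by apply: (addrI (abel f)); rewrite -abelM mulgV abel1 subrr. Qed.

Lemma abelX f n : abel (f ^+ n)%g = abel f *+ n.
Proof. by elim: n => [|n IH]; rewrite ?abel1 // expgS abelM IH mulrS. Qed.

Lemma abelJ f g : abel (f ^ g)%g = abel f.
Proof. by rewrite conjgE !abelM abelV addrCA addNr addr0. Qed.

Lemma abel_eqmod f g : (2 < k)%N -> nottingham_eqmod k f g -> abel f = abel g.
Proof.
by move=> k2 /nottingham_eqmodP fg; rewrite /abel /phi !fg // ltnW.
Qed.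

Lemma abel_eq0 f : (abel f == 0) = (f \in 'N_3).
Proof.
rewrite (@N_succ 2) // (@N_succ 1) // N1 /= /abel /phi [RHS]andbC.
rewrite -pair_eqE /=; case: eqP => [->|_]; rewrite ?andbF //.
by rewrite expr0n subr0 andbT.
Qed.

Lemma abel_mul3 (v : 'F_3 * 'F_3) : v *+ 3 = 0.
Proof.
have F3 (x : 'F_3) : x *+ 3 = 0 by rewrite -mulr_natr F3_char3 mulr0.
by case: v => x y; rewrite mulrS mulr2n; congr (_, _); apply: F3.
Qed.

(** If [f], of order 3, is conjugate to a power of [g], the exponent is prime to
    3 because [f] has a nonzero image in [N/N_3]; so [g] is in turn a power of
    that conjugate of [f], that is, a conjugate of [f] or [f^2]. *)
Lemma pr_cycle_TI3 f g : (2 < k)%N -> (f ^+ 3)%g \in 'N_k -> abel f != 0 ->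
    (forall h, ~~ nottingham_eqmod k (f ^ h)%g g) ->
    (forall h, ~~ nottingham_eqmod k ((f ^+ 2) ^ h)%g g) ->
  forall b : Q, (<[pr f]> :&: <[pr g]> :^ b = 1)%g.
Proof.
move=> k2 f3 f0 neq1 neq2; apply: (@pr_cycle_TI 0) => // h j.
rewrite expg1; apply/negP => eqfg.
have Ef : abel f = abel g *+ j by rewrite -abelX -(abel_eqmod k2 eqfg) abelJ.
have g0 : abel g != 0 by apply: contraNneq f0 => g0; rewrite Ef g0 mul0rn.
have cop3j : coprime 3 j.
  rewrite prime_coprime //; apply: contra f0 => /dvdnP[i Ej].
  by rewrite Ef Ej mulnC mulrnA abel_mul3 mul0rn.
have cop : coprime #[pr g]%g j.
  apply: (@coprime_dvdl _ (3 ^ k)); last by rewrite coprimeXl.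
  rewrite order_dvdn -prX pr_eq1; exact: (N_le (leqnSn k) (exp3_sub k g)).
have /cycleP[i Ei] : pr g \in <[pr f ^ pr h]>%g.
  rewrite -prJ (elimT (prP _ _) eqfg) prX.
  by move: cop; rewrite -generator_coprime => /eqP <-; apply: cycle_id.
have f3J : ((pr f ^ pr h) ^+ 3 = 1)%g.
  by rewrite -conjXg -prX (eqP (etrans (pr_eq1 _) f3)) conj1g.
move: Ei; rewrite -(expg_mod i f3J) -conjXg -prX -prJ => /esym/prP.
have := ltn_pmod i (isT : (0 < 3)%N); case: (i %% 3)%N => [|[|[|//]]] _.
- rewrite expg0 conj1g => /(abel_eqmod k2) /esym/eqP.
  by rewrite abel1 (negbTE g0).
- by rewrite expg1 (negbTE (neq1 h)).
by rewrite (negbTE (neq2 h)).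
Qed.

Lemma N_exists (P : {poly 'F_3}) : P`_0 = 0 -> P`_1 = 1 ->
  exists f, forall i, f i = P`_i.
Proof.
move=> P0 P1; have Pn : (P`_0 == 0) && (P`_1 == 1) by rewrite P0 P1 !eqxx.
by exists (@Nottingham 3 (fun i => P`_i) Pn).
Qed.

Lemma N_monomial n (c : 'F_3) : (0 < n)%N ->
  exists2 f, f \in 'N_n & f n.+1 = c.
Proof.
move=> n0; have [||f Ef] := @N_exists ('X + c%:P * 'X^(n.+1)).
- by rewrite coefD coefX coefCM coefXn mulr0 addr0.
- by rewrite coefD coefX coefCM coefXn eqxx eqSS (ltn_eqF n0) mulr0 addr0.
exists f; last first.
  by rewrite Ef coefD coefX coefCM coefXn eqxx mulr1 eqSS (gtn_eqF n0) add0r.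
apply/N_P => i /andP[i1 le_in].
by rewrite Ef coefD coefX coefCM coefXn (gtn_eqF i1) ltn_eqF // mulr0 addr0.
Qed.

Lemma natF3 q r : (3 * q + r)%:R = r%:R :> 'F_3.
Proof. by rewrite natrD natrM F3_char3 mul0r add0r. Qed.

(** Commuting with [v] (depth 1) raises the depth [j] by 1 unless [j] is congruent
    to 1 modulo 3; the depths that this misses are reached by commuting with [u]
    (depth 2) from a multiple of 3.  So the subgroup has elements of all depths. *)
Lemma pr_generate (u v : N) : u \in 'N_2 -> u 3%N != 0 -> v 2%N != 0 ->
  <<[set pr u; pr v]>>%g = [set: Q]%G :> {set Q}.
Proof.
move=> u2 u0 v0; pose H := <<[set pr u; pr v]>>%G; rewrite -/(gval H).
have uH : pr u \in H by rewrite mem_gen // !inE eqxx.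
have vH : pr v \in H by rewrite mem_gen // !inE eqxx orbT.
have depth j : (0 < j)%N -> exists x, [/\ x \in 'N_j, x j.+1 != 0 & pr x \in H].
  elim/ltn_ind: j => -[|[|[|j]]] // IH _.
  - by exists v; rewrite N1.
  - by exists u.
  have [E|E] := eqVneq (j.+2 %% 3)%N 1%N; last first.
    have [x [xj x0 xH]] := IH j.+2 (ltnSn _) isT.
    exists [~ x, v]%g; split.
    - by have := @N_commg j.+2 1 x v isT isT xj (N1 v); rewrite addn1.
    - have := @N_commg_lead j.+2 1 x v isT isT xj (N1 v); rewrite !addn1 => ->.
      rewrite !mulf_neq0 //.
      rewrite subr_eq0 [j.+2](divn_eq _ 3) mulnC natF3.
      by have := ltn_pmod j.+2 (isT : (0 < 3)%N); case: (_ %% _)%N E => [|[|[|]]].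
    by rewrite commgEl prM prJ prV groupM ?groupV ?groupJ.
  case: j => [|j] in IH E *; first by [].
  have [x [xj x0 xH]] := IH j.+2 (ltnW (ltnSn _)) isT.
  exists [~ x, u]%g; split.
  - by have := @N_commg j.+2 2 x u isT isT xj u2; rewrite addn2.
  - have := @N_commg_lead j.+2 2 x u isT isT xj u2; rewrite addn2 !addn1 => ->.
    rewrite !mulf_neq0 //.
    rewrite subr_eq0 [j.+2](divn_eq _ 3) mulnC natF3.
    by move: E; rewrite -addn1 -modnDml; have := ltn_pmod j.+2 (isT : (0 < 3)%N);
      case: (j.+2 %% 3)%N => [|[|[|]]].
  by rewrite commgEl prM prJ prV groupM ?groupV ?groupJ.
suff cover d : forall j f, (0 < j)%N -> (k <= j + d)%N -> f \in 'N_j -> pr f \in H.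
  apply/eqP; rewrite eqEsubset subsetT; apply/subsetP => a _.
  by have [f ->] := pr_surj a; apply: (cover k 1%N) => //; rewrite ?leq_addl ?N1.
elim: d => [|d IH] j f j0 le_k fj.
  by rewrite (eqP (etrans (pr_eq1 f) _)) ?group1 // (N_le _ fj) // -[j]addn0.
have [x [xj x0 xH]] := depth j j0.
suff [m Em] : exists m, f j.+1 + x j.+1 *+ m = 0.
  have := IH j.+1 (f * x ^+ m)%g isT; rewrite addSnnS => /(_ le_k).
  rewrite N_succ // NM ?NX // andTb coef_lead_mul ?NX // coef_lead_exp // Em eqxx.
  by move/(_ isT); rewrite prM prX groupMr ?groupX.
case: (F3_cases (f j.+1)) (F3_cases (x j.+1)) x0 => -> [] ->; rewrite ?eqxx // => _;
  solve [by exists 0%N; apply/val_inj | by exists 1%N; apply/val_inj | by exists 2%N; apply/val_inj].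
Qed.

Definition det2 (v w : 'F_3 * 'F_3) := v.1 * w.2 - w.1 * v.2.

(** Otherwise a nonzero linear form on [F_3^2] would vanish at both generators,
    hence everywhere. *)
Lemma gen_abel_det (f g : N) : (2 < k)%N ->
  <<[set pr f; pr g]>>%g = [set: Q]%G :> {set Q} ->
  det2 (abel f) (abel g) != 0.
Proof.
move=> k2 gen.
have functional (s t : 'F_3) : s * f 2%N + t * phi f = 0 ->
    s * g 2%N + t * phi g = 0 -> s = 0 /\ t = 0.
  move=> sf sg; pose chi (h : N) := s * h 2%N + t * phi h.
  have chiM : {morph chi : x y / (x * y)%g >-> x + y}.
    by move=> x y; rewrite /chi coef2M phiM; ring.
  pose H := [set a : Q | chi (generic_quotient.repr a) == 0].
  have chiH x : (pr x \in H) = (chi x == 0).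
    rewrite inE; set y := generic_quotient.repr _.
    have Ey : abel y = abel x by apply: abel_eqmod => //; apply/prP; rewrite /pr reprK.
    by rewrite -[chi y]/(s * (abel y).1 + t * (abel y).2) Ey.
  have gH : group_set H.
    apply/group_setP; split=> [|a b].
      by rewrite -pr1 chiH; apply/eqP/(addrI (chi 1%g)); rewrite -chiM mulg1 addr0.
    have [x ->] := pr_surj a; have [y ->] := pr_surj b.
    by rewrite -prM !chiH chiM => /eqP -> /eqP ->; rewrite addr0.
  have allH x : chi x = 0.
    apply/eqP; rewrite -chiH; have : pr x \in [set: Q] by rewrite inE.
    rewrite -[[set: Q]]/(gval [set: Q]%G) -gen; apply/subsetP.
    by rewrite -[H]/(gval (Group gH)) gen_subG subUset !sub1set /= !chiH /chi sf sg eqxx.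
  have [x /N_P x2 x3] := @N_monomial 2 1 isT.
  have [y /N_P _ y2] := @N_monomial 1 1 isT.
  have := allH x; rewrite /chi /phi x2 // x3 mulr0 add0r expr0n subr0 mulr1 => t0.
  by have := allH y; rewrite /chi y2 t0 mul0r addr0 mulr1.
rewrite /det2 /=; apply/negP => /eqP det.
have [pf af] : phi f = 0 /\ - f 2%N = 0.
  by apply: functional; [ring|rewrite -[RHS]oppr0 -det; ring].
have [pg ag] : phi g = 0 /\ - g 2%N = 0.
  by apply: functional; [rewrite -det; ring|ring].
have [/eqP] : 1 = 0 :> 'F_3 /\ 1 = 0 :> 'F_3; last by rewrite oner_eq0.
apply: functional; rewrite ?pf ?pg mulr0 addr0 mul1r; apply/eqP.
  by rewrite -oppr_eq0 af.
by rewrite -oppr_eq0 ag.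
Qed.
End Quotient.

(** * Quotients without a Beauville structure *)

(** An explicit list, so that statements on [F_3] are decided by evaluation. *)
Definition F3_enum : seq 'F_3 := [:: 0; 1; -1].

Lemma mem_F3_enum x : x \in F3_enum.
Proof. by case: (F3_cases x) => ->; rewrite !inE eqxx ?orbT. Qed.

Definition triple (v w : 'F_3 * 'F_3) := [:: v; w; v + w].

Lemma triple_off_axes v w : det2 v w != 0 ->
  exists2 x, x \in triple v w & (x.1 != 0) && (x.2 != 0).
Proof.
case: v w => a b [c d] det0; apply/hasP.
apply: (implyP _ det0) => {det0}.
have : all (fun a => all (fun b => all (fun c => all (fun d =>
    (det2 (a, b) (c, d) != 0) ==>
    has (fun x : 'F_3 * 'F_3 => (x.1 != 0) && (x.2 != 0)) (triple (a, b) (c, d)))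
    F3_enum) F3_enum) F3_enum) F3_enum by vm_compute.
move/allP/(_ a (mem_F3_enum a)).
move/allP/(_ b (mem_F3_enum b)).
move/allP/(_ c (mem_F3_enum c)).
move/allP/(_ d (mem_F3_enum d)).
exact.
Qed.

Lemma triple_common_line v w v' w' : det2 v w != 0 -> det2 v' w' != 0 ->
  exists2 x, x \in triple v w &
  exists2 y, y \in triple v' w' & (x != 0) && ((y == x) || (y == - x)).
Proof.
pose common v w v' w' := has (fun x : 'F_3 * 'F_3 => has (fun y =>
  (x != 0) && ((y == x) || (y == - x))) (triple v' w')) (triple v w).
move=> det0 det0'; suff /hasP[x xT /hasP[y yT xy]] : common v w v' w'.
  by exists x => //; exists y.
case: v w v' w' => a b [c d] [a' b'] [c' d'] in det0 det0' *.
have : all (fun a => all (fun b => all (fun c => all (fun d =>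
    (det2 (a, b) (c, d) != 0) ==>
    all (fun a' => all (fun b' => all (fun c' => all (fun d' =>
    (det2 (a', b') (c', d') != 0) ==> common (a, b) (c, d) (a', b') (c', d'))
    F3_enum) F3_enum) F3_enum) F3_enum)
    F3_enum) F3_enum) F3_enum) F3_enum by vm_compute.
move/allP/(_ a (mem_F3_enum a)).
move/allP/(_ b (mem_F3_enum b)).
move/allP/(_ c (mem_F3_enum c)).
move/allP/(_ d (mem_F3_enum d)).
rewrite det0.
move/allP/(_ a' (mem_F3_enum a')).
move/allP/(_ b' (mem_F3_enum b')).
move/allP/(_ c' (mem_F3_enum c')).
move/allP/(_ d' (mem_F3_enum d')).
by rewrite det0'.
Qed.

Lemma sigma_memJ (gT : finGroupType) (x y a b z : gT) :
  a \in [:: x; y; (x * y)%g] -> z \in <[a]>%g ->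
  (z ^ b)%g \in beauville_sigma [set: gT] x y.
Proof.
move=> aT za; apply/bigcupP; exists b; rewrite ?inE //.
by move: aT; rewrite !memJ_conjg !inE -orbA => /or3P[] /eqP <-; rewrite za ?orbT.
Qed.

Lemma sigma_mem (gT : finGroupType) (x y a z : gT) :
  a \in [:: x; y; (x * y)%g] -> z \in <[a]>%g ->
  z \in beauville_sigma [set: gT] x y.
Proof. by rewrite -[X in X \in beauville_sigma _ _ _]conjg1; apply: sigma_memJ. Qed.

Section Quotient.
Variable k : nat.
Local Notation Q := (nottingham_quotient 3 k).
Local Notation pr := (pr k).
Implicit Types f g h : N.

(** [N_(k-1)/N_k] has order 3. *)
Lemma pr_socle f g : (1 < k)%N -> f \in 'N_k.-1 -> g \in 'N_k.-1 ->
  f k != 0 -> g k != 0 -> pr f != 1%g /\ pr f \in <[pr g]>%g.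
Proof.
move=> k1 fk gk f0 g0.
have Ek : k = k.-1.+1 by rewrite prednK // ltnW.
have k0 : (0 < k.-1)%N by rewrite -ltnS -Ek.
have inNk h : h \in 'N_k.-1 -> h k = 0 -> pr h = 1%g.
  by move=> hk h0; apply/eqP; rewrite pr_eq1 Ek N_succ // hk -Ek h0 eqxx.
split; first by rewrite pr_eq1 Ek N_succ // fk -Ek.
suff [m Em] : exists m, f k + g k *+ m = 0.
  have : pr (f * g ^+ m)%g = 1%g.
    by apply: inNk; rewrite ?NM ?NX // Ek coef_lead_mul ?NX // coef_lead_exp // -Ek.
  rewrite prM prX => /(canRL (mulgK _)); rewrite mul1g => ->.
  by rewrite groupV mem_cycle.
case: (F3_cases (f k)) (F3_cases (g k)) f0 g0 => -> [] ->; rewrite ?eqxx // => _ _;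
  solve [by exists 1%N; apply/val_inj | by exists 2%N; apply/val_inj].
Qed.

Lemma triple_lift f g w : w \in triple (abel f) (abel g) ->
  exists2 h, pr h \in [:: pr f; pr g; (pr f * pr g)%g] & abel h = w.
Proof.
rewrite /triple -abelM !inE => /or3P[] /eqP ->;
  [exists f|exists g|exists (f * g)%g] => //; by rewrite ?prM !inE eqxx ?orbT.
Qed.

(** For [m = 0], that is [k = 2], one of the generators will do; for [m > 0], it
    is the power [3^m] of an element of the triple outside both axes. *)
Lemma gen_socle m (x y : Q) : k = nottingham_z 3 m -> [set: Q]%G :!=: 1%g ->
    <<[set x; y]>>%g = [set: Q]%G :> {set Q} ->
  exists s, [/\ s \in 'N_k.-1, s k != 0 &
    exists2 a, a \in [:: x; y; (x * y)%g] & pr s \in <[a]>%g].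
Proof.
move=> Ek nt; have [f ->] := pr_surj x; have [g ->] := pr_surj y => gen.
case: m Ek => [|m] Ek.
  rewrite nottingham_z0 in Ek.
  suff /orP[h0|h0] : (f 2%N != 0) || (g 2%N != 0).
  - exists f; split; [by rewrite Ek N1|by rewrite Ek|exists (pr f)].
      by rewrite inE eqxx.
    exact: cycle_id.
  - exists g; split; [by rewrite Ek N1|by rewrite Ek|exists (pr g)].
      by rewrite !inE eqxx orbT.
    exact: cycle_id.
  rewrite -negb_and; apply: contra nt => /andP[f0 g0].
  rewrite -gen /= (_ : [set _; _] = [set 1%g]) ?genGid ?gen_set1 //.
  have E h : h 2%N == 0 -> pr h = 1%g.
    by move=> h0; apply/eqP; rewrite pr_eq1 Ek N_succ // N1.
  by rewrite !E // setUid.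
have k2 : (2 < k)%N by rewrite Ek (leq_trans _ (nottingham_z_ge _)) // addn2.
have [w wT /andP[w2 wphi]] := triple_off_axes (gen_abel_det k2 gen).
have [h hT Eh] := triple_lift wT.
rewrite -Eh in w2 wphi; have [sn s0] := exp3_depth m.+1 w2 wphi.
rewrite -Ek in sn s0.
exists (h ^+ (3 ^ m.+1))%g; split=> //.
by exists (pr h) => //; rewrite prX mem_cycle.
Qed.

Lemma not_beauville_z m : k = nottingham_z 3 m -> ~ beauville_group [set: Q]%G.
Proof.
move=> Ek [nt [x1 [y1 [x2 [y2 [gen1 gen2 TI]]]]]].
have k1 : (1 < k)%N by rewrite Ek (leq_trans _ (nottingham_z_ge _)) // addn2.
have [s1 [s1n s10 [a1 a1T s1a]]] := gen_socle Ek nt gen1.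
have [s2 [s2n s20 [a2 a2T s2a]]] := gen_socle Ek nt gen2.
have [s1_nt s12] := pr_socle k1 s1n s2n s10 s20.
case/eqP: s1_nt; apply/set1P; rewrite -set1gE -TI inE (sigma_mem a1T) //.
apply: (sigma_mem a2T); apply: subsetP s12.
by rewrite cycle_subG.
Qed.

(** Such [f] and [g] differ modulo [N_4] by the coefficient of [t^4], which
    commutators with elements of depth 1 or 2 change at will. *)
Lemma abel_conj4 f g : abel f = abel g -> abel f != 0 ->
  exists h, nottingham_eqmod 4 (f ^ h)%g g.
Proof.
move=> fg f0.
have conj4 h : [~ f, h]%g \in 'N_3 -> f 4%N + [~ f, h]%g 4%N = g 4%N ->
    nottingham_eqmod 4 (f ^ h)%g g.
  move=> c3 E4; rewrite -[(f ^ h)%g](mulKVg f) -commgEl; apply/nottingham_eqmodP => i lt_i.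
  rewrite (coef_mul_sub _ _ c3) //.
  have E2 : f 2%N = g 2%N := congr1 fst fg.
  have E3 : f 3%N = g 3%N by move: (congr1 snd fg : phi f = phi g); rewrite /phi E2 => /addIr.
  have [le_i3|] := leqP i 3; last first.
    by case: i lt_i => [|[|[|[|[|i]]]]] // _ _; rewrite -E4 subr0.
  rewrite (N_coefE c3 le_i3) subrr addr0.
  by case: i le_i3 {lt_i} => [|[|[|[|]]]] //; rewrite ?coefs0 ?coefs1.
have [a0|a0] := eqVneq (f 2%N) 0.
  have b0 : f 3%N != 0.
    by apply: contraNneq f0 => b0; rewrite /abel /phi a0 b0 expr0n subr0.
  have f2 : f \in 'N_2 by rewrite N_succ // N1 a0 eqxx.
  have [h hn Eh] := @N_monomial 1 ((g 4%N - f 4%N) / f 3%N) isT.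
  exists h; apply: conj4; first exact: (@N_commg 2 1).
  rewrite (@N_commg_lead 2 1) // Eh mulrCA divff // mulr1.
  by rewrite (_ : 2%:R - 1%:R = 1 :> 'F_3) ?mulr1 ?subrKC //; apply/val_inj.
have [h hn Eh] := @N_monomial 2 ((f 4%N - g 4%N) / f 2%N) isT.
exists h; apply: conj4; first by apply: (@N_commg 1 2); rewrite ?N1.
rewrite (@N_commg_lead 1 2) ?N1 // Eh mulrCA divff // mulr1.
by rewrite (_ : 1%:R - 2%:R = -1 :> 'F_3) ?mulrN1 ?opprB ?subrKC //; apply/val_inj.
Qed.

Lemma not_beauville_34 : (2 < k <= 4)%N -> ~ beauville_group [set: Q]%G.
Proof.
move=> /andP[k2 k4] [nt [x1 [y1 [x2 [y2 []]]]]].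
have [f1 ->] := pr_surj x1; have [g1 ->] := pr_surj y1.
have [f2 ->] := pr_surj x2; have [g2 ->] := pr_surj y2 => gen1 gen2 TI.
have [v vT [w wT /andP[v0 vw]]] :=
  triple_common_line (gen_abel_det k2 gen1) (gen_abel_det k2 gen2).
have [s sT Es] := triple_lift vT; have [t tT Et] := triple_lift wT.
have [t' t'T Et'] : exists2 t', pr t' \in <[pr t]>%g & abel s = abel t'.
  case/orP: vw => /eqP vw; [exists t|exists t^-1%g].
  - exact: cycle_id.
  - by rewrite Es Et vw.
  - by rewrite prV groupV cycle_id.
  - by rewrite abelV Es Et vw opprK.
have s0 : abel s != 0 by rewrite Es.
have [h /nottingham_eqmodP sh] := abel_conj4 Et' s0.
have E : pr (s ^ h)%g = pr t'.
  by apply/prP/nottingham_eqmodP => i lt_i; rewrite sh // (leq_trans lt_i).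
have : pr t' \in (1%g : {set Q}).
  rewrite -TI inE (sigma_mem tT) // andbT -E prJ.
  by apply: (sigma_memJ _ sT); apply: cycle_id.
move/set1P/eqP; rewrite pr_eq1 => t'k.
by case/negP: s0; rewrite Et' abel_eq0 (N_le k2).
Qed.

Lemma not_beauville_1 : (k <= 1)%N -> ~ beauville_group [set: Q]%G.
Proof.
move=> k1 [/eqP[]]; apply/setP=> a; rewrite inE; apply/esym/set1P.
by have [f ->] := pr_surj a; apply/eqP; rewrite pr_eq1 (N_le k1) ?N1.
Qed.

End Quotient.

(** * Elements of order 3 *)

Section Cancellation.
Variable F : fieldType.
Implicit Types P Q W : {poly F}.

Lemma dvdXn_mul_unit m P W : W`_0 != 0 -> O m (P * W) -> O m P.
Proof.
move=> W0; rewrite Gauss_dvdpl // coprimep_expl // -['X]subr0 coprimep_sym.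
by rewrite coprimep_XsubC /root horner_coef0.
Qed.

Lemma sqr_cancel m P Q : 2%:R != 0 :> F -> O 2 (P - 'X) -> O 2 (Q - 'X) ->
  O m.+1 (P ^+ 2 - Q ^+ 2) -> O m (P - Q).
Proof.
move=> two /dvdpP[A EA] /dvdpP[B EB].
have -> : P ^+ 2 - Q ^+ 2 = (P - Q) * (2%:R + (A + B) * 'X) * 'X.
  have -> : P = A * 'X^2 + 'X by rewrite -EA subrK.
  have -> : Q = B * 'X^2 + 'X by rewrite -EB subrK.
  by ring.
rewrite exprSr dvdp_mul2r ?polyX_eq0 //; apply: dvdXn_mul_unit.
by rewrite coefD coefMX addr0 -polyC_natr coefC.
Qed.

Hypothesis char3 : 3%:R = 0 :> F.

Lemma exp3D1 M P : (1 + P) ^+ (3 ^ M) = 1 + P ^+ (3 ^ M).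
Proof.
elim: M => [|M IH]; first by rewrite !expr1.
rewrite !expnSr !exprM IH; set R := P ^+ _.
have -> : (1 + R) ^+ 3 = 1 + R ^+ 3 + 3%:R * (R + R ^+ 2) by ring.
by rewrite (poly_char3 char3) mul0r addr0.
Qed.

(** For [e E + 1 = 3^M] this approximates [t (1 + c t^e)^(-1/e)], the conjugate
    under [t |-> t^e] of the homography [s / (1 + c s)], which has order 3. *)
Definition ord3_poly (e E : nat) (c : F) : {poly F} :=
  'X * (1 + c%:P * 'X^e) ^+ E.

Lemma ord3_poly_low e E c : O (e + 1) (ord3_poly e E c - 'X).
Proof.
rewrite /ord3_poly -[X in _ - X]mulr1 -mulrBr subrX1 addrC addKr -mulrA.
rewrite addn1 exprS dvdp_mul // mulrCA.
by rewrite dvdp_mulr.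
Qed.

Lemma ord3_polyE e E M c : (e * E + 1 = 3 ^ M)%N -> (0 < e)%N ->
  O (3 ^ M) (ord3_poly e E c ^+ e * (1 + c%:P * 'X^e) - 'X^e).
Proof.
move=> EM e0.
have -> : ord3_poly e E c ^+ e * (1 + c%:P * 'X^e) - 'X^e
    = 'X^e * (c%:P ^+ (3 ^ M) * 'X^(e * 3 ^ M)).
  rewrite /ord3_poly exprMn -exprM -mulrA -exprSr -addn1 mulnC EM exp3D1.
  by rewrite exprMn -exprM; ring.
by rewrite !dvdp_mull // dvdXn_X // leq_pmull.
Qed.

(** Iterating [P^e = t^e / (1 + c t^e)] replaces [c] by [2c], then by [3c = 0]. *)
Lemma ord3_cube m e c P : O 1 P -> O m (P ^+ e * (1 + c%:P * 'X^e) - 'X^e) ->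
  O m (((P \Po P) \Po P) ^+ e - 'X^e).
Proof.
move=> P1; set W := 1 + _; set R0 := (X in O _ X) => OR0.
pose P2 := P \Po P; pose P3 := P2 \Po P.
have W_P : W \Po P = 1 + c%:P * P ^+ e.
  by rewrite /W comp_polyD comp_polyM !comp_polyC comp_Xn_poly.
pose R1 := R0 \Po P.
have OR1 : O m R1 by exact: dvdXn_comp.
have ER1 : R1 = P2 ^+ e * (1 + c%:P * P ^+ e) - P ^+ e.
  rewrite /R1 /R0 comp_polyB comp_polyM W_P comp_Xn_poly.
  by rewrite -[P ^+ e \Po P]/(comp_poly P (P ^+ e)) rmorphXn.
pose S := P2 ^+ e * (1 + c%:P * 'X^e *+ 2) - 'X^e.
have ES : S = R1 * W + R0 - c%:P * R0 * P2 ^+ e.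
  by rewrite /S ER1 /R0 /W; ring.
have OS : O m S.
  rewrite ES; apply: dvdp_add; first by rewrite dvdp_add // dvdp_mulr.
  by rewrite dvdpNr dvdp_mulr // dvdp_mull.
have OSP : O m (S \Po P) by exact: dvdXn_comp.
have ESP : S \Po P = P3 ^+ e * (1 + c%:P * P ^+ e *+ 2) - P ^+ e.
  rewrite /S comp_polyB comp_polyM comp_polyD mulr2n comp_polyD !comp_polyM.
  rewrite !comp_polyC !comp_Xn_poly mulr2n; congr (_ * _ - _).
  by rewrite -[P2 ^+ e \Po P]/(comp_poly P (P2 ^+ e)) rmorphXn.
have -> : P3 ^+ e - 'X^e = R0 + (S \Po P) * W - c%:P *+ 2 * R0 * P3 ^+ e
     - 3%:R * (c%:P * 'X^e * P3 ^+ e).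
  by rewrite ESP /R0 /W; ring.
rewrite (poly_char3 char3) mul0r subr0.
apply: dvdp_add; first by rewrite dvdp_add // dvdp_mulr.
by rewrite dvdpNr dvdp_mulr // dvdp_mull.
Qed.

End Cancellation.

Section Elements.
Variable k : nat.
Local Notation Q := (nottingham_quotient 3 k).
Local Notation pr := (pr k).
Implicit Types f g h : N.

Lemma coef_mul_poly f g (P R : {poly 'F_3}) :
    (forall i, f i = P`_i) -> (forall i, g i = R`_i) ->
  forall i, (f * g)%g i = (P \Po R)`_i.
Proof.
move=> fP gR i; rewrite (coef_mul _ _ (ltnSn i)).
apply: (@comp_poly_congr _ i.+1) => //= [|j lt_j|j lt_j]; rewrite ?trunc0 //.
  by rewrite coef_trunc lt_j.
by rewrite coef_trunc lt_j.
Qed.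

Lemma F3_two : 2%:R != 0 :> 'F_3. Proof. by []. Qed.

Lemma ltn_exp3 n : (n < 3 ^ n)%N. Proof. exact: ltn_expl. Qed.

Lemma ord3_elt e E M (c : 'F_3) : (e * E + 1 = 3 ^ M)%N -> (0 < e)%N ->
  exists f, (forall i, f i = (ord3_poly e E c)`_i) /\
    forall i, (f ^+ 3)%g i =
      (((ord3_poly e E c) \Po (ord3_poly e E c)) \Po (ord3_poly e E c))`_i.
Proof.
move=> EM e0; set P := ord3_poly e E c.
have P2 : O 2 (P - 'X).
  by apply: (dvdXn_le _ (ord3_poly_low e E c)); rewrite addn1 ltnS.
have PX i : (i < 2)%N -> P`_i = 'X`_i by move: i; apply/dvdXn_subP.
have [||f fP] := @N_exists P; rewrite ?PX ?coefX //.
exists f; split=> // i.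
have ff := coef_mul_poly fP fP; rewrite (_ : f ^+ 3 = f * (f * f))%g //.
by rewrite (coef_mul_poly fP ff) comp_polyA.
Qed.

Lemma exists_ord3_depth2 : exists u : N, (u ^+ 3)%g \in 'N_k /\
  forall i, (i < 6)%N -> u i = ('X + 'X^3 : {poly 'F_3})`_i.
Proof.
pose M := k.+2; pose E := (3 ^ M)./2.
have EM : (2 * E + 1 = 3 ^ M)%N.
  by rewrite /E mul2n -[RHS]odd_double_half oddX /= addnC.
have [f [fP f3]] := ord3_elt 1 EM isT; set P := ord3_poly 2 E 1 in fP f3.
have leM : (k.+2 < 3 ^ M)%N by exact: ltn_exp3.
have OP := ord3_polyE F3_char3 1 EM isT; rewrite -/P in OP.
have P2 : O 2 (P - 'X) by apply: (dvdXn_le _ (ord3_poly_low 2 E 1)).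
have P1 : O 1 P by rewrite -(subrK 'X P) dvdp_add ?expr1 // -[X in X %| _]expr1 (dvdXn_le _ P2).
exists f; split.
  apply/nottingham_subP => i lt_i; rewrite f3 /= /series_id -coefX.
  move: i lt_i; apply/dvdXn_subP; apply: sqr_cancel F3_two _ _ _.
  - have PP : O 2 ((P \Po P) - 'X).
      rewrite -(subrK P (P \Po P)) -addrA dvdp_add //.
      exact: (@comp_diff_dvd _ 1).
    have -> : ((P \Po P) \Po P) - 'X = comp_diff P (P \Po P) + ((P \Po P) - 'X).
      by rewrite /comp_diff; ring.
    by rewrite dvdp_add // (@comp_diff_dvd _ 1).
  - by rewrite subrr dvdp0.
  by apply: (dvdXn_le _ (ord3_cube F3_char3 P1 OP)); apply: ltnW.
move=> i lt_i; rewrite fP; move: i lt_i; apply/dvdXn_subP.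
apply: sqr_cancel F3_two P2 _ _; first by rewrite addrAC subrr add0r dvdXn_X.
apply: (@dvdXn_mul_unit _ _ _ (1 + 1%:P * 'X^2)).
  by rewrite coefD coef1 coefCM coefXn mulr0 addr0 oner_eq0.
have -> : (P ^+ 2 - ('X + 'X^3) ^+ 2) * (1 + 1%:P * 'X^2)
  = (P ^+ 2 * (1 + 1%:P * 'X^2) - 'X^2) - 'X^8
    - 3%:R * ('X^4 + 'X^6) by rewrite polyC1; ring.
rewrite (poly_char3 F3_char3) mul0r subr0 dvdp_add ?dvdpNr ?dvdXn_X //.
apply: (dvdXn_le _ OP); apply: (@leq_trans (3 ^ 2)) => //.
by rewrite leq_exp2l.
Qed.

(** The witness is [t / (1 - t)], up to high order. *)
Lemma exists_ord3_depth1 : exists v : N, (v ^+ 3)%g \in 'N_k /\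
  forall i, (0 < i < 7)%N -> v i = 1.
Proof.
pose M := k.+2; pose E := (3 ^ M).-1.
have EM : (1 * E + 1 = 3 ^ M)%N by rewrite mul1n addn1 prednK // expn_gt0.
have [f [fP f3]] := ord3_elt (-1) EM isT; set P := ord3_poly 1 E (-1) in fP f3.
have leM : (k.+2 < 3 ^ M)%N by exact: ltn_exp3.
have OP := ord3_polyE F3_char3 (-1) EM isT; rewrite -/P !expr1 in OP.
have P2 : O 2 (P - 'X) by apply: (dvdXn_le _ (ord3_poly_low 1 E (-1))).
have P1 : O 1 P by rewrite -(subrK 'X P) dvdp_add ?expr1 // -[X in X %| _]expr1 (dvdXn_le _ P2).
exists f; split.
  apply/nottingham_subP => i lt_i; rewrite f3 /= /series_id -coefX.
  move: i lt_i; apply/dvdXn_subP.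
  have := ord3_cube F3_char3 P1 (_ : O (3 ^ M) (P ^+ 1 * (1 + (-1)%:P * 'X^1) - 'X^1)).
  rewrite !expr1 => /(_ OP) OC; apply: (dvdXn_le _ OC).
  exact: leq_trans (leqnSn _) (ltnW leM).
pose S : {poly 'F_3} := \poly_(i < 7) (0 < i)%:R.
have ES : S * (1 - 'X) = 'X - 'X^7.
  rewrite /S poly_def !big_ord_recl big_ord0 /= /bump /=.
  by rewrite scale0r !scale1r; ring.
suff fS i : (i < 7)%N -> f i = S`_i.
  by move=> i /andP[i0 i7]; rewrite fS // coef_poly i7 i0.
move=> lt_i; rewrite fP; move: i lt_i; apply/dvdXn_subP.
apply: (@dvdXn_mul_unit _ _ _ (1 - 'X)).
  by rewrite coefB coef1 coefX subr0 oner_eq0.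
have -> : (P - S) * (1 - 'X) = P * (1 + (-1)%:P * 'X) - 'X + 'X^7.
  by rewrite mulrBl ES polyCN; ring.
rewrite dvdp_add // (dvdXn_le _ OP) //; apply: (@leq_trans (3 ^ 2)) => //.
by rewrite leq_exp2l.
Qed.

(** * Elements that are not conjugate *)

(** If [u^h = u'] modulo [t^6], then [u(h) = h + t^3 + O(t^6)] and [h(u')] would
    agree, but the coefficients of [t^5] are [h_5] and [h_5 + 1]. *)
Lemma ord3_depth2_nonconj (u u' : N) h : (4 < k)%N ->
    (forall i, (i < 6)%N -> u i = ('X + 'X^3 : {poly 'F_3})`_i) ->
    (forall i, (i < 6)%N -> u' i = ('X + 'X^3 + 'X^5 : {poly 'F_3})`_i) ->
  ~~ nottingham_eqmod k (u ^ h)%g u'.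
Proof.
move=> k4 uP u'P; apply/negP => /nottingham_eqmodP conj.
have : (u * h)%g 5%N = (h * u')%g 5%N.
  rewrite -[(u * h)%g](mulKVg h) -conjgE; apply: (@nottingham_mul_congr _ 6) => // i lt_i.
  by rewrite conj // (leq_trans lt_i).
pose H := tr 6 h; pose V : {poly 'F_3} := 'X + 'X^3 + 'X^5.
have OH : O 2 (H - 'X) by apply: (@N_trunc 6 1) (N1 h).
have OV : O 3 (V - 'X).
  have -> : V - 'X = 'X^3 + 'X^5 by rewrite /V; ring.
  by rewrite dvdp_add // dvdXn_X.
have -> : (u * h)%g 5%N = (H + (H - 'X) ^+ 3 + 'X^3)`_5.
  rewrite (@coef_mul 6) //.
  transitivity ((('X + 'X^3) \Po H)`_5).
    apply: (@comp_poly_congr _ 6) => // [|i lt_i]; first exact: trunc0.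
    by rewrite coef_trunc lt_i uP.
  rewrite comp_polyD comp_polyX comp_Xn_poly (_ : _ + _ + 'X^3 = H + H ^+ 3) //.
  by rewrite (cubeB F3_char3); ring.
have -> : (h * u')%g 5%N = (H \Po V)`_5.
  rewrite (@coef_mul 6) //.
  apply: (@comp_poly_congr _ 6) => // [|i lt_i]; first exact: trunc0.
  by rewrite coef_trunc lt_i u'P.
have := @N_trunc2 6 1 h isT isT (N1 h); rewrite -/H; set R := (X in O _ X) => OR.
have HE : H = 'X + (h 2%N)%:P * 'X^2 + (h 3%N)%:P * 'X^3 + R by rewrite /R; ring.
clearbody R.
have -> : H \Po V = H + comp_diff V H by rewrite /comp_diff addrC subrK.
have [T O6 ->] : exists2 T, O 6 T &
    comp_diff V H = 'X^3 + 'X^5 + (h 2%N *+ 2)%:P * 'X^4 + T.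
  exists ((h 2%N)%:P * ('X^6 *+ 3 + 'X^8 *+ 2 + 'X^10)
      + (h 3%N)%:P * comp_diff V ('X ^+ 3) + comp_diff V R); last first.
    rewrite HE !comp_diff_D !comp_diff_C comp_diffX [comp_diff V 'X^2]/comp_diff comp_Xn_poly /V.
    by rewrite polyCMn; ring.
  apply: dvdp_add; last by apply: (dvdXn_le _ (dvdXn_comp_diff OV OR)).
  apply: dvdp_add; apply: dvdp_mull.
    by rewrite !dvdp_add -?scaler_nat ?dvdpZr ?dvdXn_X.
  by apply: (@comp_diff_cube _ F3_char3 2 1); rewrite ?expr1 ?dvdpp.
have {OH} : O 6 ((H - 'X) ^+ 3) by apply: dvdXn_pow OH.
move: ((H - 'X) ^+ 3) => T' O6'.
rewrite !coefD (dvdXn_coef O6) // (dvdXn_coef O6') // !coefXn coefCM coefXn /=.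
by rewrite mulr0 !addr0 => /eqP; rewrite eq_sym -subr_eq0 addrAC subrr !add0r oner_eq0.
Qed.

Lemma coefD1Xn (F : fieldType) n i : ((1 + 'X : {poly F}) ^+ n)`_i = 'C(n, i)%:R.
Proof.
rewrite addrC exprD1n coef_sum.
have [lt_in|le_in] := ltnP i n.+1; last first.
  rewrite bin_small // big1 // => j _; rewrite coefMn coefXn.
  by rewrite gtn_eqF ?mul0rn // (leq_trans (ltn_ord j)).
rewrite (bigD1 (Ordinal lt_in)) //= coefMn coefXn eqxx big1 ?addr0 // => j ne_ji.
rewrite coefMn coefXn (_ : (i == j) = false) ?mul0rn //.
by apply: contraNF ne_ji => /eqP E; apply/eqP/val_inj; rewrite /= E.
Qed.

(** The coefficient of [t^n] in [(t (1 + t)^5)^i]. *)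
Definition conj_coef (i n : nat) : 'F_3 :=
  if (n < i)%N then 0 else 'C(5 * i, n - i)%:R.

(** The coefficients of [t^4], [t^5] and [t^6] in the equation [h (1 - y) = y] for
    [h = t + a t^2 + b t^3 + c t^4 + d t^5 + e t^6] and [y = h(t (1 + t)^5)]. *)
Definition conj_eqs (a b c d e : 'F_3) :=
  let y2 := a - 1 in let y3 := b + a + 1 in let y4 := c + 1 in
  let y5 := d - c - 1 in let y6 := e + d + c - b + 1 in
  [&& c - (y3 + a * y2 + b) == y4,
      d - (y4 + a * y3 + b * y2 + c) == y5 &
      e - (y5 + a * y4 + b * y3 + c * y2 + d) == y6].

Lemma conj_eqs_unsolvable a b c d e : conj_eqs a b c d e = false.
Proof.
have : all (fun a => all (fun b => all (fun c => all (fun d => all (fun e =>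
    ~~ conj_eqs a b c d e) F3_enum) F3_enum) F3_enum) F3_enum) F3_enum.
  by vm_compute.
move/allP/(_ a (mem_F3_enum a)); move/allP/(_ b (mem_F3_enum b)).
move/allP/(_ c (mem_F3_enum c)); move/allP/(_ d (mem_F3_enum d)).
by move/allP/(_ e (mem_F3_enum e))/negbTE.
Qed.

(** As [v] has order 3, [(v^2)^h = v'] means [v(y) = h] for [y = h(v')].  Since
    [v = t / (1 - t)], this is the equation [h (1 - y) = y], which has no solution
    modulo [t^7]. *)
Lemma ord3_depth1_nonconj (v v' : N) h : (5 < k)%N -> (v ^+ 3)%g \in 'N_k ->
    (forall i, (0 < i < 7)%N -> v i = 1) ->
    (forall i, (i < 7)%N -> v' i = ('X * (1 + 'X) ^+ 5 : {poly 'F_3})`_i) ->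
  ~~ nottingham_eqmod k ((v ^+ 2) ^ h)%g v'.
Proof.
move=> k5 v3 vP v'P; apply/negP => /nottingham_eqmodP conj.
pose y := (h * v')%g; pose Y := tr 7 y; pose H := tr 7 h.
have vy i : (i < 7)%N -> (v * y)%g i = h i.
  move=> lt_i; transitivity ((v ^+ 3 * h)%g i).
    have -> : (v ^+ 3 * h)%g = (v * (h * (v ^+ 2) ^ h))%g.
      by rewrite conjgE mulKVg mulgA -expgS.
    apply: (@nottingham_mul_congr _ 7) => // j lt_j.
    apply: (@nottingham_mul_congr _ 7) => // l lt_l.
    by rewrite conj // (leq_trans lt_l).
  rewrite -[h in RHS]mul1g; apply: (@nottingham_mul_congr _ 7) => // j lt_j.
  by move/nottingham_subP: v3; apply; rewrite (leq_trans lt_j).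
have eqH : O 7 (H * (1 - Y) - Y).
  pose V : {poly 'F_3} := tr 7 v.
  have EV : V * (1 - 'X) = 'X - 'X^7.
    rewrite /V /series_trunc poly_def !big_ord_recl big_ord0 /= /bump /=.
    by rewrite coefs0 !vP // scale0r !scale1r; ring.
  have OH : O 7 (H - (V \Po Y)).
    apply/dvdXn_subP => i lt_i.
    by rewrite -(coef_mul _ _ lt_i) vy // coef_trunc lt_i.
  have -> : H * (1 - Y) - Y = (H - (V \Po Y)) * (1 - Y) - Y ^+ 7.
    have := congr1 (comp_poly Y) EV; rewrite /= !rmorphM !rmorphB /=.
    rewrite comp_polyX comp_polyC comp_Xn_poly => E.
    by rewrite mulrBl E; ring.
  apply: dvdp_add; first by rewrite dvdp_mulr.
  rewrite dvdpNr; apply: (@dvdXn_pow _ 1 7) => //.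
  by apply/dvdXnP => -[|//] _; rewrite /Y trunc0.
have yE n : (n < 7)%N -> y n = \sum_(i < 7) h i * conj_coef i n.
  move=> lt_n; rewrite (coef_mul _ _ lt_n).
  transitivity ((H \Po ('X * (1 + 'X) ^+ 5))`_n).
    apply: (@comp_poly_congr _ 7) => // [|i lt_i]; first exact: trunc0.
    by rewrite coef_trunc lt_i v'P.
  rewrite /H /series_trunc poly_def raddf_sum coef_sum /=; apply: eq_bigr => i _.
  rewrite linearZ /= comp_Xn_poly coefZ exprMn -exprM coefXnM coefD1Xn.
  by rewrite /conj_coef.
have bc i n x : conj_coef i n == x -> conj_coef i n = x by move/eqP.
have y_sum n : (n < 7)%N -> y n = conj_coef 1 n + h 2%N * conj_coef 2 n
    + h 3%N * conj_coef 3 n + h 4%N * conj_coef 4 n + h 5%N * conj_coef 5 n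
    + h 6%N * conj_coef 6 n.
  by move=> /yE ->; rewrite !big_ord_recr big_ord0 /= coefs0 coefs1 mul0r !add0r mul1r.
have y2 : y 2%N = h 2%N - 1.
  rewrite y_sum // (bc 1 2 (-1)) // (bc 2 2 1) // (bc 3 2 0) // (bc 4 2 0) //.
  by rewrite (bc 5 2 0) // (bc 6 2 0) //; ring.
have y3 : y 3%N = h 3%N + h 2%N + 1.
  rewrite y_sum // (bc 1 3 1) // (bc 2 3 1) // (bc 3 3 1) // (bc 4 3 0) //.
  by rewrite (bc 5 3 0) // (bc 6 3 0) //; ring.
have y4 : y 4%N = h 4%N + 1.
  rewrite y_sum // (bc 1 4 1) // (bc 2 4 0) // (bc 3 4 0) // (bc 4 4 1) //.
  by rewrite (bc 5 4 0) // (bc 6 4 0) //; ring.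
have y5 : y 5%N = h 5%N - h 4%N - 1.
  rewrite y_sum // (bc 1 5 (-1)) // (bc 2 5 0) // (bc 3 5 0) // (bc 4 5 (-1)) //.
  by rewrite (bc 5 5 1) // (bc 6 5 0) //; ring.
have y6 : y 6%N = h 6%N + h 5%N + h 4%N - h 3%N + 1.
  rewrite y_sum // (bc 1 6 1) // (bc 2 6 0) // (bc 3 6 (-1)) // (bc 4 6 1) //.
  by rewrite (bc 5 6 1) // (bc 6 6 1) //; ring.
have eq_n n : (n < 7)%N -> h n - \sum_(i < n.+1) h i * y (n - i)%N = y n.
  move=> lt_n; have /eqP := dvdXn_coef eqH lt_n.
  rewrite coefB mulrBr mulr1 coefB coefM subr_eq0 !coef_trunc lt_n => /eqP <-.
  congr (_ - _); apply: eq_bigr => i _; rewrite !coef_trunc.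
  by rewrite (leq_trans (ltn_ord i)) // (leq_ltn_trans (leq_subr _ _)).
have y1 : y 1%N = 1 by exact: coefs1.
have conv (F : nat -> 'F_3) : [/\ \sum_(i < 5) F i = F 0%N + F 1%N + F 2%N + F 3%N + F 4%N,
     \sum_(i < 6) F i = F 0%N + F 1%N + F 2%N + F 3%N + F 4%N + F 5%N
   & \sum_(i < 7) F i = F 0%N + F 1%N + F 2%N + F 3%N + F 4%N + F 5%N + F 6%N].
  by rewrite !big_ord_recr big_ord0 /= add0r.
have y0 : y 0%N = 0 by exact: coefs0.
have h0 := coefs0 h; have h1 := coefs1 h.
have : conj_eqs (h 2%N) (h 3%N) (h 4%N) (h 5%N) (h 6%N).
  rewrite /conj_eqs; apply/and3P; split; apply/eqP.
  - have := eq_n 4 isT; have [-> _ _] := conv (fun i => h i * y (4 - i)%N).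
    by rewrite h0 h1 y0 y1 y2 y3 y4 => <-; ring.
  - have := eq_n 5 isT; have [_ -> _] := conv (fun i => h i * y (5 - i)%N).
    by rewrite h0 h1 y0 y1 y2 y3 y4 y5 => <-; ring.
  have := eq_n 6 isT; have [_ _ ->] := conv (fun i => h i * y (6 - i)%N).
  by rewrite h0 h1 y0 y1 y2 y3 y4 y5 y6 => <-; ring.
by rewrite conj_eqs_unsolvable.
Qed.
End Elements.

(** * Quotients with a Beauville structure *)

Lemma nottingham_z_interval k : (1 < k)%N ->
  exists m, (nottingham_z 3 m <= k < nottingham_z 3 m.+1)%N.
Proof.
case: k => [|[|k]] // _; elim: k => [|k [m /andP[zm zm1]]].
  by exists 0%N; rewrite nottingham_zS nottingham_z0.
have [lt_z|ge_z] := ltnP k.+3 (nottingham_z 3 m.+1).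
  by exists m; rewrite lt_z (leq_trans zm).
exists m.+1; rewrite ge_z [nottingham_z 3 m.+2]nottingham_zS.
by move: zm1 ge_z; clear; lia.
Qed.

(** The power [w^(3^m)], of depth [z_m - 1], has two leading coefficients that
    are nontrivial modulo [N_k], and they determine the line of [w] in [F_3^2].
    A power of [g] with the same coefficients would commute with [g], so [g] would
    be on the same line. *)
Lemma off_axis_TI k m (w g : N) : (0 < m)%N ->
    (nottingham_z 3 m < k < nottingham_z 3 m.+1)%N ->
    w 2%N != 0 -> phi w != 0 -> det2 (abel w) (abel g) != 0 ->
  forall b, (<[pr k w]> :&: <[pr k g]> :^ b = 1)%g.
Proof.
move=> m0 /andP[lt_zk lt_kz] w2 wphi det; apply: (@pr_cycle_TI _ m).
  have [wn _] := exp3_depth m.+1 w2 wphi; apply: N_le wn.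
  by move: lt_kz; clear; lia.
move=> h j; apply/negP => conj; case/negP: det.
have [sn s0] := exp3_depth m w2 wphi.
have [q Ez] := nottingham_z_mod m; set n := (nottingham_z 3 m).-1 in sn.
have En : n = (3 * q).+1 by rewrite /n Ez.
have En1 : nottingham_z 3 m = (n + 1)%N by rewrite En Ez addn1.
have q0 : (0 < q)%N.
  by have := nottingham_z_ge m; move: m0; rewrite Ez; clear; lia.
rewrite En1 in s0 lt_zk.
set s := (w ^+ (3 ^ m))%g in sn s0 conj; pose s' := (g ^+ j)%g.
have lead i : (i < n + 3)%N -> s' i = s i.
  by apply: (conj_lead En _ sn conj); move: lt_zk; clear; lia.
have s'n : s' \in 'N_n.
  apply/nottingham_subP => i lt_i; rewrite lead; last by move: lt_i; clear; lia.
  by move/nottingham_subP: sn; apply.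
have Ew : w 2%N * s (n + 2)%N = s (n + 1)%N * phi w.
  by apply: (comm_lead En q0 sn); apply: commuteX.
have Eg : g 2%N * s (n + 2)%N = s (n + 1)%N * phi g.
  rewrite -!lead ?ltn_add2l //.
  by apply: (comm_lead En q0 s'n); apply: commuteX.
rewrite -(mulrI_eq0 _ (mulfI s0)) /det2 /= mulrBr mulrCA -Eg mulrCA mulrA.
by rewrite [X in _ - X]mulrCA -Ew; apply/eqP; ring.
Qed.

Lemma beauville_quotient k m : (5 < k)%N -> (0 < m)%N ->
    (nottingham_z 3 m < k < nottingham_z 3 m.+1)%N ->
  beauville_group [set: nottingham_quotient 3 k]%G.
Proof.
move=> k5 m0 lt_zkz; have k2 : (2 < k)%N by apply: leq_trans k5.
have [u [u3 uP]] := exists_ord3_depth2 k; have [v [v3 vP]] := exists_ord3_depth1 k.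
have [||u' u'P] := @N_exists ('X + 'X^3 + 'X^5).
- by rewrite !coefD !coefXn coefX /= !addr0.
- by rewrite !coefD !coefXn coefX /= !addr0.
have coefv' i : ('X * (1 + 'X) ^+ 5 : {poly 'F_3})`_i
    = if i is i'.+1 then 'C(5, i')%:R else 0.
  by rewrite coefXM; case: i => //= i; rewrite coefD1Xn.
have [||v' v'P] := @N_exists ('X * (1 + 'X) ^+ 5); rewrite ?coefv' //.
have Eu : abel u = (0, 1).
  rewrite /abel /phi !uP // !coefD !coefXn !coefX.
  by congr (_, _); apply/val_inj.
have Eu' : abel u' = (0, 1).
  rewrite /abel /phi !u'P !coefD !coefXn !coefX.
  by congr (_, _); apply/val_inj.
have Ev : abel v = (1, 0) by rewrite /abel /phi !vP // expr1n subrr.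
have Ev' : abel v' = (-1, 0).
  by rewrite /abel /phi !v'P !coefv'; congr (_, _); apply/val_inj.
have conj_abel f g h : nottingham_eqmod k (f ^ h)%g g -> abel g = abel f.
  by move/(abel_eqmod k2); rewrite abelJ.
have v0 : abel v != 0 by rewrite Ev.
have u0 : abel u != 0 by rewrite Eu.
have TIu g : (abel g != abel u) -> (abel g != abel u *+ 2) ->
    forall b, (<[pr k u]> :&: <[pr k g]> :^ b = 1)%g.
  move=> neq1 neq2; apply: pr_cycle_TI3 => // h; apply/negP => /conj_abel E.
    by rewrite E eqxx in neq1.
  by rewrite E abelX eqxx in neq2.
have TIv g : (abel g != abel v) -> (abel g != abel v *+ 2) ->
    forall b, (<[pr k v]> :&: <[pr k g]> :^ b = 1)%g.
  move=> neq1 neq2; apply: pr_cycle_TI3 => // h; apply/negP => /conj_abel E.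
    by rewrite E eqxx in neq1.
  by rewrite E abelX eqxx in neq2.
have TIuu' b : (<[pr k u]> :&: <[pr k u']> :^ b = 1)%g.
  apply: pr_cycle_TI3 => // h; last first.
    by apply/negP => /conj_abel/eqP; rewrite abelX Eu Eu'.
  by apply: ord3_depth2_nonconj => [|//|i _]; [apply: leq_trans k5|].
have TIvv' b : (<[pr k v]> :&: <[pr k v']> :^ b = 1)%g.
  apply: pr_cycle_TI3 => // h.
    by apply/negP => /conj_abel/eqP; rewrite Ev Ev'.
  by apply: ord3_depth1_nonconj => // i _.
have Ew : abel (u * v)%g = (1, 1) by rewrite abelM Eu Ev; apply/eqP.
have Ew' : abel (u' * v')%g = (-1, 1) by rewrite abelM Eu' Ev'; apply/eqP.
have TIw g : det2 (1, 1) (abel g) != 0 ->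
    forall b, (<[pr k (u * v)%g]> :&: <[pr k g]> :^ b = 1)%g.
  rewrite -Ew => det; apply: off_axis_TI m0 lt_zkz _ _ det.
    by rewrite (congr1 fst Ew : (u * v)%g 2%N = 1).
  by rewrite (congr1 snd Ew : phi (u * v)%g = 1).
have nt : [set: nottingham_quotient 3 k]%G :!=: 1%g.
  apply: contraNneq v0 => trivQ; rewrite abel_eq0 (N_le k2) // -pr_eq1.
  have : pr k v \in [set: nottingham_quotient 3 k]%G by rewrite inE.
  by rewrite trivQ => /set1P ->.
split=> //; exists (pr k u), (pr k v), (pr k u'), (pr k v'); split.
- apply: pr_generate; last by rewrite vP.
    by rewrite N_succ // N1 (congr1 fst Eu : u 2%N = 0).
  by rewrite uP // !coefD !coefXn coefX.
- apply: pr_generate; last by rewrite (congr1 fst Ev' : v' 2%N = -1).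
    by rewrite N_succ // N1 (congr1 fst Eu' : u' 2%N = 0).
  by rewrite u'P !coefD !coefXn coefX.
apply: beauville_sigma_TI => a b; rewrite -!prM !inE.
by case/or3P=> /eqP-> /or3P[] /eqP-> g; first [exact: TIuu' | exact: TIvv'
  | apply: TIu; rewrite ?Eu ?Eu' ?Ev' ?Ew' | apply: TIv; rewrite ?Ev ?Eu' ?Ev' ?Ew'
  | apply: TIw; rewrite ?Eu' ?Ev' ?Ew'].
Qed.

Theorem theorem3p10 (k : nat) (k_ge1 : (1 <= k)%N) :
  beauville_group [set: nottingham_quotient 3 k]%G <->
  ((6 <= k)%N /\ forall m : nat, (1 <= m)%N -> k <> nottingham_z 3 m).
Proof.
split=> [beau|[k6 neqz]].
  split; last by move=> m _ /not_beauville_z; apply.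
  rewrite leqNgt; apply/negP => k5.
  have [k1|k1] := leqP k 1; first exact: not_beauville_1 k1 beau.
  have [k2|k2] := leqP k 2.
    by apply: (@not_beauville_z k 0) beau; rewrite nottingham_z0; apply/eqP; rewrite eqn_leq k2.
  have [k4|k4] := leqP k 4; first by apply: (@not_beauville_34 k) beau; rewrite k2.
  apply: (@not_beauville_z k 1) beau; rewrite nottingham_zS nottingham_z0.
  by apply/eqP; rewrite eqn_leq -ltnS k5.
have [m /andP[zk kz]] := nottingham_z_interval (ltn_trans (isT : (1 < 5)%N) k6).
have m0 : (0 < m)%N.
  by case: m kz {zk} => // kz; move: k6 kz; rewrite nottingham_zS nottingham_z0; clear; lia.
apply: (beauville_quotient k6 m0); rewrite kz andbT ltn_neqAle zk andbT.
by apply/eqP => E; apply: (neqz m m0).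
Qed.
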